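(* Let $N_1<N_2<\cdots$ and $M_1<M_2<\cdots$ be natural numbers, $\mathbf{N}=([N_s])_{s\in\mathbb{N}}$, $\mathbf{P}_W=(\mathcal{P}_W\cap[M_t])_{t\in\mathbb{N}}$. Suppose $\mathcal{A}\subset\ell^\infty(\mathbb{Z})$ is a separable, affinely invariant $C^*$-subalgebra that admits logarithmic averages along $\mathbf{N}$ and iterated affine correlations along $\mathbf{P}_W$ for all $W\in\mathbb{N}$. Let $a_1,a_2,\ldots\in\mathbb{N}$ and let $f\in\mathcal{A}$ satisfy $f(n)\ge0$ for all $n\in\mathbb{N}$. Then for every $\epsilon>0$ and every $W\in\mathbb{N}$ there exist $k\ge2$ and an infinite set $I\subset\mathbb{N}$ such that for all $i,j\in I$ with $i<j$, $$\mathbb{E}^{\log}_{p\in\mathbf{P}_W^{*k}}\mathbb{E}^{\log}_{n\in\mathbf{N}}f(a_in)\,f(a_jpn)\ \ge\ \Big(\limsup_{j\to\infty}\mathbb{E}^{\log}_{n\in\mathbf{N}}f(a_jn)\Big)^2-\epsilon.$$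
   Context: $\mathbb{N}=\{1,2,\dots\}$, $[N]=\{1,\dots,N\}$, $\mathcal{P}$ the primes, $\mathcal{P}_W=\{p\in\mathcal{P}:p\equiv1\bmod W\}$. For finite nonempty $B\subset\mathbb{N}$, $\mathbb{E}^{\log}_{n\in B}f(n)=\big(\sum_{n\in B}f(n)/n\big)/\big(\sum_{n\in B}1/n\big)$. $\ell^\infty(\mathbb{Z})$ is the space of bounded functions $\mathbb{Z}\to\mathbb{C}$; a $C^*$-subalgebra is a sup-norm-closed subset containing $1_{\mathbb{Z}}$ closed under linear combinations, products and complex conjugation; separable: has a countable dense subset; affinely invariant: $f\circ\tau^b,f\circ\sigma_a\in\mathcal{A}$ for $f\in\mathcal{A}$, $b\in\mathbb{Z}$, $a\in\mathbb{N}$ ($\tau^b(n)=n+b$, $\sigma_a(n)=an$). $\mathcal{A}$ admits logarithmic averages along $\mathbf{N}$ if $\mathbb{E}^{\log}_{n\in\mathbf{N}}f(n):=\lim_{s\to\infty}\mathbb{E}^{\log}_{n\in[N_s]}f(n)$ exists for all $f\in\mathcal{A}$. It admits iterated affine correlations along $\mathbf{P}_W$ if for all $f,g\in\mathcal{A}$, $k,a\in\mathbb{N}$ and integer polynomials $Q$ the iterated limit $\lim_{t_k\to\infty}\mathbb{E}^{\log}_{p_k\in\mathcal{P}_W\cap[M_{t_k}]}\cdots\lim_{t_1\to\infty}\mathbb{E}^{\log}_{p_1\in\mathcal{P}_W\cap[M_{t_1}]}\big(\lim_{s\to\infty}\mathbb{E}^{\log}_{n\in[N_s]}f(an+Q(p_k\cdots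 p_1))g(p_k\cdots p_1n)\big)$ exists; it is denoted $\mathbb{E}^{\log}_{p\in\mathbf{P}_W^{*k}}\mathbb{E}^{\log}_{n\in\mathbf{N}}f(an+Q(p))g(pn)$ (the expression in the claim is the case $Q=0$, $a=a_i$, with $g=f\circ\sigma_{a_j}$). *)

(* Defs.v *)
From HB Require Import structures.
From mathcomp Require Import all_boot all_order all_algebra.
From mathcomp Require Import complex.
From mathcomp Require Import all_classical all_reals all_analysis.
Set Implicit Arguments.
Unset Strict Implicit.
Unset Printing Implicit Defensive.
Import Order.TTheory GRing.Theory Num.Theory.
Import numFieldNormedType.Exports.
Local Open Scope classical_set_scope.
Local Open Scope ring_scope.
Local Open Scope complex_scope.

(* The library puts the topology induced by the modulus on the alias R[i]^o
   only; it is transported here to R[i] itself. *)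
HB.instance Definition _ (R : realType) :=
  PseudoPointedMetric.copy R[i] R[i]^o.
HB.instance Definition _ (R : realType) := NormedModule.copy R[i] R[i]^o.

Section Averages.
Variable R : realType.
Implicit Types (f g : int -> R[i]) (N M : nat -> nat) (W k a : nat).

Definition primes_mod W : pred nat :=
  [pred p | prime p && (p == 1 %[mod W])%N].

Definition interval_seq m : seq nat := index_iota 1 m.+1.

Definition primes_mod_seq W m : seq nat :=
  [seq p <- interval_seq m | primes_mod W p].

(* The finite set B is given by a duplicate-free list.  The value is 0 for
   empty B; this may happen for the first few sets P_W `&` [M_t], and has no
   influence on limits in t. *)
Definition Elog (B : seq nat) (h : nat -> R[i]) : R[i] :=
  (\sum_(n <- B) h n / n%:R) / (\sum_(n <- B) n%:R^-1).

(* Sequences indexed by the positive integers are represented by functions on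
   nat, with a shift of the index by one. *)

(* For u : nat -> nat -> R[i], [iter_Elog W M k u] is
     lim_(t_k) E^log_(p_k in P_W `&` [M_(t_k)]) ...
       lim_(t_1) E^log_(p_1 in P_W `&` [M_(t_1)]) lim_s u (p_k ... p_1) s;
   the recursion peels off the outermost variable p_k. *)
Fixpoint iter_Elog W M k (u : nat -> nat -> R[i]) : R[i] :=
  if k is k'.+1 then
    limn (fun t => Elog (primes_mod_seq W (M t))
                     (fun p => iter_Elog W M k' (fun q => u (p * q)%N)))
  else limn (u 1%N).

(* Existence of all the limits occurring in [iter_Elog W M k u]. *)
Fixpoint iter_Elog_exists W M k (u : nat -> nat -> R[i]) : Prop :=
  if k is k'.+1 then
    (forall p, primes_mod W p ->
       iter_Elog_exists W M k' (fun q => u (p * q)%N)) /\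
    cvgn (fun t => Elog (primes_mod_seq W (M t))
                     (fun p => iter_Elog W M k' (fun q => u (p * q)%N)))
  else cvgn (u 1%N).

Definition ell_infty : set (int -> R[i]) :=
  [set f | exists C : R, forall n, `|f n| <= C%:C].

Definition sup_norm f : R := sup (range (fun n => complex.Re `|f n|)).

Record Cstar_subalgebra (A : set (int -> R[i])) : Prop := {
  Cstar_bounded : A `<=` ell_infty;
  Cstar_one : A (fun=> 1);
  Cstar_linear : forall (c : R[i]) f g,
    A f -> A g -> A (fun n => c * f n + g n);
  Cstar_mul : forall f g, A f -> A g -> A (fun n => f n * g n);
  Cstar_conj : forall f, A f -> A (fun n => (f n)^*);
  Cstar_closed : forall f, ell_infty f ->
    (forall e : R, 0 < e -> exists2 g, A g & sup_norm (fun n => f n - g n) < e) ->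
    A f }.

Definition sup_separable (A : set (int -> R[i])) : Prop :=
  exists D : set (int -> R[i]), [/\ D `<=` A, countable D &
    forall f, A f -> forall e : R, 0 < e ->
      exists2 g, D g & sup_norm (fun n => f n - g n) < e].

Definition affinely_invariant (A : set (int -> R[i])) : Prop :=
  (forall f (b : int), A f -> A (fun n => f (n + b))) /\
  (forall f a, (0 < a)%N -> A f -> A (fun n => f (a%:Z * n))).

Definition log_average N (h : nat -> R[i]) : nat -> R[i] :=
  fun s => Elog (interval_seq (N s)) h.

Definition admits_log_averages N (A : set (int -> R[i])) : Prop :=
  forall f, A f -> cvgn (log_average N (fun n => f n%:Z)).

Definition admits_iterated_affine_correlations N W M
    (A : set (int -> R[i])) : Prop :=
  forall f g k a (Q : {poly int}), A f -> A g -> (0 < k)%N -> (0 < a)%N ->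
    iter_Elog_exists W M k (fun p =>
      log_average N (fun n => f ((a * n)%:Z + Q.[p%:Z]) * g (p * n)%:Z)).

End Averages.

(* Main.v *)
(** Put [F_i n = f (a_i n)] and let [c] be the limsup of the
    means of the [F_i]; pass to indices whose mean exceeds [c - delta].  If for
    every [k = 2, 4, ..., 2K] almost all pairs (in the sense of an ultrafilter)
    violated the inequality, a Ramsey argument would give [F_1, ..., F_K] all of
    whose pairs violate it for all these [k].  Consider
    [G = sum_r F_r (p_1 ... p_{2r} n)], averaged over [n] and the primes [p_i].
    By the Turan-Kubilius inequality an average over [p] in [P_W] of a
    logarithmic average over [n] is unchanged when [n] is replaced by [p n].
    Hence [G] has mean [sum_r mean F_r], while the [(r, s)] term of its second
    moment is the correlation with [k = 2 (s - r)]; Cauchy-Schwarz is violated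
    for large [K].  Limits along an ultrafilter are used throughout, so that no
    existence question arises; they agree with the limits of the statement.

    The Turan-Kubilius step needs [sum_{p in P_W} 1/p = oo], that is, Dirichlet's
    theorem for the class 1.  Let [s h] be the limiting share of the class [h]
    in [sum_{d <= x} Lambda(d)/d].  The identities [ln = Lambda * 1] and
    [Lambda + (ln x) delta_1 = mu * ln (x/.) * 1], summed against functions of
    mean zero on the unit group [U], show that [chi g = 1 - |U| s (g^-1)] satisfies
    [|chi| <= 1], [sum_n chi(n)/n = 0] and
    [|U| chi g = sum_h chi (h^-1) chi (g h)].  The equality case of the
    triangle inequality makes [chi] either zero or a real character; the latter
    is excluded by comparing [sum_n chi(n) z^n/(1 - z^n)] with
    [sum_n chi(n)/(n (1 - z))] as [z -> 1]. *)

Require Import Defs.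
From mathcomp Require Import all_boot all_order all_algebra.
From mathcomp Require Import complex.
From mathcomp Require Import all_classical all_reals all_analysis.
From mathcomp Require Import ring lra zify.
Set Implicit Arguments.
Unset Strict Implicit.
Unset Printing Implicit Defensive.
Import Order.TTheory GRing.Theory Num.Theory.
Import numFieldNormedType.Exports.
Local Open Scope classical_set_scope.
Local Open Scope ring_scope.
Local Open Scope complex_scope.

(** * Arithmetic functions *)

Section DivisorSums.
Variable V : nmodType.

Lemma sum_multiples (d x : nat) (F : nat -> V) : (0 < d)%N ->
  \sum_(1 <= n < x.+1 | (d %| n)%N) F (n %/ d)%N =
  \sum_(1 <= m < (x %/ d).+1) F m.
Proof.
move=> d0; elim: x => [|x IH]; first by rewrite div0n !big_geq.
rewrite big_mkcond big_nat_recr //= -big_mkcond IH divnS //.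
case: (boolP (d %| x.+1)%N) => dx /=; last by rewrite addr0 add0n.
by rewrite add1n [RHS]big_nat_recr //= divnS // dx.
Qed.

Lemma sum_divisors (n : nat) (F : nat -> V) : (0 < n)%N ->
  \sum_(d <- divisors n) F d = \sum_(1 <= d < n.+1 | (d %| n)%N) F d.
Proof.
move=> n0; rewrite -[RHS]big_filter; apply: perm_big; apply: uniq_perm.
- exact: divisors_uniq.
- by rewrite filter_uniq // iota_uniq.
move=> d; rewrite mem_filter mem_index_iota -dvdn_divisors //.
case: (boolP (d %| n)%N) => //= dn.
by rewrite (dvdn_gt0 n0 dn) ltnS dvdn_leq.
Qed.

(** Writing [n = d m] turns a summed Dirichlet convolution into a double sum over [d m <= x]. The
    identities for [Lambda], [mu] and characters enter the estimates below in this form. *)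
Lemma dirichlet_sum (x : nat) (F : nat -> nat -> V) :
  \sum_(1 <= n < x.+1) \sum_(d <- divisors n) F d (n %/ d)%N =
  \sum_(1 <= d < x.+1) \sum_(1 <= m < (x %/ d).+1) F d m.
Proof.
transitivity (\sum_(1 <= n < x.+1) \sum_(1 <= d < x.+1 | (d %| n)%N)
    F d (n %/ d)%N).
  apply: eq_big_nat => n /andP[n0 nx]; rewrite sum_divisors //.
  rewrite [RHS](big_cat_nat (n := n.+1)) //= [X in _ = _ + X]big_nat_cond.
  rewrite [X in _ + X]big1 ?addr0 // => d /andP[/andP[nd _]].
  by move=> /(dvdn_leq n0); rewrite leqNgt nd.
rewrite (exchange_big_dep_nat xpredT) //=; apply: eq_big_nat => d /andP[d0 _].
by rewrite -sum_multiples.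
Qed.

(** Unique factorisation [d = p^i e] with [i = logn p d]; with [pfactor_ind] it reduces divisor sums
    to one prime at a time. *)
Lemma divisors_pfactor (p a m : nat) (F : nat -> V) :
  prime p -> ~~ (p %| m)%N -> (0 < m)%N ->
  \sum_(d <- divisors (p ^ a * m)) F d =
  \sum_(0 <= i < a.+1) \sum_(e <- divisors m) F (p ^ i * e)%N.
Proof.
move=> pp pm m0.
have pe e : e \in divisors m -> coprime p e.
  rewrite -dvdn_divisors // => em; rewrite prime_coprime //.
  by apply: contra pm => /dvdn_trans; apply.
have e0 e : e \in divisors m -> (0 < e)%N.
  by rewrite -dvdn_divisors // => /dvdn_gt0; apply.
have p0 := prime_gt0 pp.
rewrite -(@big_allpairs_dep _ _ _ _ _ _ (fun i e => p ^ i * e)%N (index_iota 0 a.+1) (fun=> divisors m) F).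
apply: perm_big; apply: uniq_perm; first exact: divisors_uniq.
  apply: allpairs_uniq; [exact: iota_uniq|exact: divisors_uniq|].
  move=> x y /allpairsP[[i1 e1] [_ h1 ->]] /allpairsP[[i2 e2] [_ h2 ->]].
  rewrite /= in h1 h2 * => E.
  have E2 : i1 = i2.
    have := congr1 (logn p) E.
    rewrite !lognM ?expn_gt0 ?p0 ?e0 // !pfactorK //.
    by rewrite !(logn_coprime (pe _ _)) // !addn0.
  move: E; rewrite E2 => /eqP; rewrite eqn_pmul2l ?expn_gt0 ?p0 //.
  by move=> /eqP ->.
move=> d; rewrite -dvdn_divisors ?muln_gt0 ?expn_gt0 ?p0 //.
apply/idP/allpairsP => [dn|[[i e] /= [+ + ->]]]; last first.
  rewrite mem_index_iota /= ltnS -dvdn_divisors // => ia em.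
  by rewrite dvdn_mul // dvdn_exp2l.
have d0 : (0 < d)%N by apply: dvdn_gt0 dn; rewrite muln_gt0 expn_gt0 p0.
have [e pe' de] := pfactor_coprime pp d0.
have em : (e %| m)%N.
  have : (e %| p ^ a * m)%N.
    by apply: dvdn_trans dn; rewrite de dvdn_mulr.
  by rewrite Gauss_dvdr // coprime_sym coprimeXl.
exists (logn p d, e) => /=; split; last by rewrite mulnC.
  rewrite mem_index_iota /= ltnS.
  have := dvdn_leq_log p _ dn; rewrite lognM ?expn_gt0 ?p0 // pfactorK //.
  rewrite [X in (_ + X)%N]logn_coprime ?prime_coprime // addn0.
  by apply; rewrite muln_gt0 expn_gt0 p0.
by rewrite -dvdn_divisors.
Qed.

End DivisorSums.

(** Strips the full power of the least prime factor. The clause [m < p ^ a * m] records that the new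
    number is not 1. *)
Lemma pfactor_ind (P : nat -> Prop) : P 1%N ->
  (forall p a m, prime p -> (0 < a)%N -> ~~ (p %| m)%N -> (0 < m)%N ->
     (m < p ^ a * m)%N -> P m -> P (p ^ a * m)%N) ->
  forall n, (0 < n)%N -> P n.
Proof.
move=> P1 PS; elim/ltn_ind => n IH n0.
have [n1|n1] := leqP n 1.
  by have -> : n = 1%N by apply/eqP; rewrite eqn_leq n1.
have pp := pdiv_prime n1.
have [m pm E] := pfactor_coprime pp n0.
have a0 : (0 < logn (pdiv n) n)%N by rewrite logn_gt0 mem_primes pp n0 pdiv_dvd.
have m0 : (0 < m)%N by move: n0; rewrite {1}E muln_gt0 => /andP[].
rewrite prime_coprime // in pm.
have lt : (m < pdiv n ^ logn (pdiv n) n * m)%N.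
  rewrite -[X in (X < _)%N]mul1n ltn_pmul2r //.
  by rewrite -(exp1n (logn (pdiv n) n)) ltn_exp2r ?prime_gt1.
rewrite E mulnC; apply: PS => //; apply: IH => //.
by move: lt; rewrite mulnC -E.
Qed.

(** * Moebius and von Mangoldt functions *)

Section Mobius.
Variable R : realType.

Definition mobius (n : nat) : R :=
  \prod_(p <- primes n) (if (p ^ 2 %| n)%N then 0 else -1).

Lemma mobius_bound n : `|mobius n| <= 1.
Proof.
rewrite /mobius; apply: (big_ind (fun x : R => `|x| <= 1)).
- by rewrite normr1.
- by move=> x y hx hy; rewrite normrM -[1]mulr1 ler_pM.
- by move=> p _; case: ifP => _; rewrite ?normr0 ?normrN ?normr1 ?ler01.
Qed.

Lemma mobius_pfactor p i e : prime p -> ~~ (p %| e)%N -> (0 < e)%N -> (0 < i)%N ->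
  mobius (p ^ i * e) = if i == 1%N then - mobius e else 0.
Proof.
move=> pp pe e0 i0; have p0 := prime_gt0 pp; have p1 := prime_gt1 pp.
have cpe : coprime p e by rewrite prime_coprime.
have pr : perm_eq (primes (p ^ i * e)) (p :: primes e).
  apply: uniq_perm; first exact: primes_uniq.
    by rewrite /= primes_uniq andbT mem_primes (negbTE pe) !andbF.
  move=> q; rewrite primesM ?expn_gt0 ?p0 // primesX // primes_prime //.
  by rewrite !inE.
rewrite /mobius (perm_big _ pr) big_cons.
case: (eqVneq i 1%N) => [->|i1]; last first.
  have -> : (p ^ 2 %| p ^ i * e)%N.
    by apply/dvdn_mulr/dvdn_exp2l; case: i i0 i1 {pr} => [|[]].
  by rewrite /= mul0r.
rewrite expn1 expnS dvdn_pmul2l // expn1 (negbTE pe) /= mulN1r; congr (- _).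
rewrite !big_seq; apply: eq_bigr => q; rewrite mem_primes => /and3P[qp _ qe].
have : coprime (q ^ 2) p.
  rewrite coprimeXl // prime_coprime // dvdn_prime2 //.
  by apply: contraNneq pe => <-.
by move=> /Gauss_dvdr ->.
Qed.

Lemma sum_mobius n : (0 < n)%N ->
  \sum_(d <- divisors n) mobius d = (n == 1%N)%:R.
Proof.
move: n; apply: pfactor_ind; first by rewrite big_seq1 /mobius big_nil.
move=> p a m pp a0 pm m0 mlt _; rewrite divisors_pfactor //.
(* Exponents above 1 contribute nothing; the terms for exponents 0 and 1 cancel. *)
case: a a0 mlt => // a _ mlt; rewrite 2?big_nat_recl //= [X in _ + (_ + X)]big1_seq.
  rewrite addr0 expn0 -big_split big1_seq /=; last first.
    move=> e; rewrite -dvdn_divisors // => em; rewrite mul1n mobius_pfactor //.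
    - by rewrite subrr.
    - by apply: contra pm => /dvdn_trans; apply.
    - exact: dvdn_gt0 em.
  by rewrite gtn_eqF //; apply: leq_ltn_trans mlt.
move=> i _; rewrite big1_seq //= => e; rewrite -dvdn_divisors // => em.
rewrite mobius_pfactor //; last exact: dvdn_gt0 em.
by apply: contra pm => /dvdn_trans; apply.
Qed.

(** Since [pdiv n] is the least prime factor, the test says that [n > 1] is a power of a single
    prime. *)
Definition vonMangoldt (n : nat) : R :=
  if (1 < n)%N && (pdiv n).-nat n then ln (pdiv n)%:R else 0.

Lemma vonMangoldt_ge0 n : 0 <= vonMangoldt n.
Proof.
rewrite /vonMangoldt; case: ifP => // /andP[n1 _].
by rewrite ln_ge0 // ler1n pdiv_gt0.
Qed.

Lemma vonMangoldt_pfactor p i e : prime p -> ~~ (p %| e)%N -> (0 < e)%N ->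
  (0 < i)%N -> vonMangoldt (p ^ i * e) = if e == 1%N then ln p%:R else 0.
Proof.
move=> pp pe e0 i0; have p0 := prime_gt0 pp.
have pi1 : (1 < p ^ i)%N by rewrite -(exp1n i) ltn_exp2r // prime_gt1.
case: (eqVneq e 1%N) => [->|e1].
  rewrite muln1 /vonMangoldt pi1.
  by case: i i0 pi1 => // i _ _; rewrite pdiv_pfactor // pnatX pnat_id.
rewrite /vonMangoldt; case: ifP => // /andP[_]; set q := pdiv _.
have e1' : (1 < e)%N by rewrite ltn_neqAle eq_sym e1.
rewrite pnatM => /andP[h1 h2].
have qp : p = q.
  move/(pnatP _ (ltnW pi1)): h1 => /(_ p pp).
  by rewrite dvdn_exp // => /(_ isT) /eqP.
move/(pnatP _ e0): h2 => /(_ (pdiv e) (pdiv_prime e1')).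
by rewrite pdiv_dvd => /(_ isT) /eqP; rewrite -qp => E; rewrite -E pdiv_dvd in pe.
Qed.

Lemma sum_vonMangoldt n : (0 < n)%N ->
  \sum_(d <- divisors n) vonMangoldt d = ln n%:R.
Proof.
move: n; apply: pfactor_ind.
  by rewrite big_seq1 /vonMangoldt ln1.
move=> p a m pp a0 pm m0 mlt IH; rewrite divisors_pfactor //.
rewrite big_nat_recl // expn0; under [X in X + _]eq_bigr do rewrite mul1n.
have p0 := prime_gt0 pp.
rewrite IH natrM lnM ?posrE ?ltr0n ?expn_gt0 ?p0 // addrC; congr (_ + _).
rewrite natrX lnXn ?ltr0n // (eq_big_nat _ _ (F2 := fun=> ln p%:R)).
  by rewrite big_const_nat subn0 iter_addr_0.
move=> i /andP[_ ia]; rewrite (bigD1_seq 1%N) ?divisors_uniq //=; last first.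
  by rewrite -dvdn_divisors.
rewrite vonMangoldt_pfactor // ?eqxx ?big1_seq ?addr0 //.
  move=> e /andP[e1]; rewrite -dvdn_divisors // => em.
  rewrite vonMangoldt_pfactor ?(negbTE e1) //; last exact: dvdn_gt0 em.
  by apply: contra pm => /dvdn_trans; apply.
by rewrite dvdn1 gtn_eqF // prime_gt1.
Qed.

(** Pairing the divisors [e] and [p e] leaves [- ln p] times the sum of [mobius e] over the divisors
    of [m], which [sum_mobius] evaluates. *)
Lemma sum_mobius_ln n : (0 < n)%N ->
  \sum_(d <- divisors n) mobius d * ln d%:R = - vonMangoldt n.
Proof.
move: n; apply: pfactor_ind.
  by rewrite big_seq1 /vonMangoldt ln1 mulr0 oppr0.
move=> p a m pp a0 pm m0 mlt _.
have pd e : e \in divisors m -> ~~ (p %| e)%N /\ (0 < e)%N.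
  rewrite -dvdn_divisors // => em; split; last exact: dvdn_gt0 em.
  by apply: contra pm => /dvdn_trans; apply.
rewrite divisors_pfactor // vonMangoldt_pfactor //.
case: a a0 mlt => // a _ _; rewrite 2?big_nat_recl //= [X in _ + (_ + X)]big1_seq.
  transitivity (\sum_(e <- divisors m) - ln p%:R * mobius e).
    rewrite addr0 -big_split; apply: eq_big_seq => e em /=.
    have [pe e0] := pd e em.
    rewrite expn0 mul1n mobius_pfactor // ?eqxx /= expn1 natrM.
    rewrite lnM ?posrE ?ltr0n ?(prime_gt0 pp) // !mulNr mulrDr opprD.
    by rewrite addrCA subrr addr0 mulrC.
  rewrite -mulr_sumr sum_mobius //.
  by case: eqP => _; rewrite ?mulr1 ?mulr0 ?oppr0.
move=> i _; rewrite big1_seq //= => e em; have [pe e0] := pd e em.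
by rewrite mobius_pfactor // mul0r.
Qed.

Lemma vonMangoldt_le d : vonMangoldt d <= ln d%:R.
Proof.
have [->|d0] := posnP d; first by rewrite /vonMangoldt /= ln0.
rewrite -(sum_vonMangoldt d0) (bigD1_seq d) ?divisors_uniq //=.
  by rewrite lerDl sumr_ge0 // => i _; exact: vonMangoldt_ge0.
by rewrite -dvdn_divisors.
Qed.

Lemma vonMangoldt_prime p : prime p -> vonMangoldt p = ln p%:R.
Proof.
move=> pp; have := @vonMangoldt_pfactor p 1 1 pp.
by rewrite muln1 expn1 dvdn1 gtn_eqF ?prime_gt1 //; apply.
Qed.

Lemma vonMangoldt_neq0 d : vonMangoldt d != 0 ->
  [/\ prime (pdiv d), (0 < logn (pdiv d) d)%N, d = (pdiv d ^ logn (pdiv d) d)%N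
    & vonMangoldt d = ln (pdiv d)%:R].
Proof.
rewrite /vonMangoldt; case: ifP => [/andP[d1 dn] _|_]; last by rewrite eqxx.
have pp := pdiv_prime d1.
split=> //; first by rewrite logn_gt0 mem_primes pp pdiv_dvd (ltnW d1).
by rewrite -p_part part_pnat_id.
Qed.

End Mobius.

(** * Chebyshev and Mertens estimates *)

Section Chebyshev.
Variable R : realType.
Implicit Types (x d n m k : nat).

Lemma ln_nat_ge0 n : 0 <= ln n%:R :> R.
Proof. by case: n => [|n]; [rewrite ln0|rewrite ln_ge0 // ler1n]. Qed.

Lemma ler_ln_nat n m : (n <= m)%N -> ln n%:R <= ln m%:R :> R.
Proof.
case: n => [|n] nm; first by rewrite ln0 // ln_nat_ge0.
by rewrite ler_ln ?posrE ?ltr0n ?ler_nat //; exact: leq_trans nm.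
Qed.

Lemma ln_succ n : (0 < n)%N -> n%:R * (ln n.+1%:R - ln n%:R) <= 1 :> R.
Proof.
move=> n0; have n0' : 0 < n%:R :> R by rewrite ltr0n.
rewrite -ln_div ?posrE ?ltr0n //.
have -> : n.+1%:R / n%:R = 1 + n%:R^-1 :> R.
  by rewrite -natr1 mulrDl divff ?gt_eqF // mul1r.
have := @le_ln1Dx R n%:R^-1; rewrite (lt_trans (ltrN10 R)) ?invr_gt0 // => /(_ isT).
by rewrite -(ler_pM2l n0') divff ?gt_eqF.
Qed.

Definition lnfact x : R := \sum_(1 <= n < x.+1) ln n%:R.

Lemma lnfactS x : lnfact x.+1 = lnfact x + ln x.+1%:R.
Proof. by rewrite /lnfact big_nat_recr. Qed.

Lemma lnfact_le x : lnfact x <= x%:R * ln x%:R.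
Proof.
elim: x => [|x IH]; first by rewrite /lnfact big_geq // mul0r.
rewrite lnfactS -natr1 mulrDl mul1r natr1 lerD2r; apply: le_trans IH _.
by rewrite ler_wpM2l ?ler0n // ler_ln_nat.
Qed.

(** A weak Stirling bound; its induction step is [ln_succ]. *)
Lemma lnfact_ge x : x%:R * ln x%:R - x%:R <= lnfact x.
Proof.
elim: x => [|x IH]; first by rewrite /lnfact big_geq // mul0r subr0.
rewrite lnfactS; case: x IH => [_|x IH].
  by rewrite ln1 mulr0 sub0r /lnfact big_geq // addr0 oppr_le0.
have := ln_succ (ltn0Sn x); move: IH.
move: (ln x.+1%:R : R) (ln x.+2%:R : R) (lnfact _) => a b c.
by rewrite -[x.+2%:R]natr1; nra.
Qed.

(** Legendre's formula for the logarithm of [x!]. *)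
Lemma lnfact_vonMangoldt x :
  lnfact x = \sum_(1 <= d < x.+1) vonMangoldt R d * (x %/ d)%:R.
Proof.
have := dirichlet_sum x (fun d _ => vonMangoldt R d).
under eq_big_nat => n /andP[n0 _] do rewrite sum_vonMangoldt //.
rewrite -/(lnfact x) => ->; apply: eq_bigr => d _.
by rewrite sumr_const_nat subSS subn0 mulr_natr.
Qed.

Definition psi x : R := \sum_(1 <= d < x.+1) vonMangoldt R d.

(** The left side is the logarithm of the central binomial coefficient. Each induction step adds at
    most [2 ln 2], and [ln 2 <= 1] is enough. *)
Lemma lnfact_double n : lnfact (n + n) - 2 * lnfact n <= 2 * n%:R.
Proof.
elim: n => [|n IH]; first by rewrite /lnfact big_geq // !mulr0 subr0.
have l2 : ln 2 <= 1 :> R.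
  by have := @le_ln1Dx R 1; rewrite (lt_trans (ltrN10 R)) // => /(_ isT).
have E : (n.+1 + n.+1 = (n + n).+2)%N by rewrite addnS addSn.
have e2 : ln (n + n).+2%:R = ln 2 + ln n.+1%:R :> R.
  by rewrite -lnM ?posrE ?ltr0n // -E addnn -mul2n natrM.
have := @ler_ln_nat (n + n).+1 (n + n).+2 (leqnSn _); rewrite e2 E !lnfactS e2.
move: (ln 2) (ln n.+1%:R : R) l2 (ln (n + n).+1%:R : R) (lnfact n) (lnfact (n + n)) IH.
by move=> a b l2 c d e IH; rewrite -[n.+1%:R]natr1; nra.
Qed.

(** In Legendre's formula [Lambda d] gets the weight [(2n %/ d) - 2 (n %/ d)], which is nonnegative
    for [d <= n] and at least 1 for [n < d <= 2n]. *)
Lemma psi_double n : psi (n + n) <= psi n + 2 * n%:R.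
Proof.
rewrite -lerBlDl; apply: le_trans (lnfact_double n).
rewrite lerBrDl !lnfact_vonMangoldt /psi.
rewrite [X in X - _](big_cat_nat (n := n.+1)) //= ?ltnS ?leq_addr //.
rewrite addrAC subrr add0r [X in _ <= X](big_cat_nat (n := n.+1)) //= ?ltnS ?leq_addr //.
apply: lerD.
  rewrite mulr_sumr; apply: ler_sum_nat => d /andP[d0 _].
  rewrite mulrCA ler_wpM2l ?vonMangoldt_ge0 // -natrM ler_nat.
  by rewrite leq_divRL // -mulnA mul2n -addnn leq_add // leq_trunc_div.
apply: ler_sum_nat => d /andP[nd dn]; rewrite -[X in X <= _]mulr1.
by rewrite ler_wpM2l ?vonMangoldt_ge0 // ler1n divn_gt0 // (leq_trans _ nd).
Qed.

(** Halving induction on [psi_double]; for odd [x] the extra term is at most [ln x <= x - 1]. *)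
Lemma chebyshev x : psi x <= 4 * x%:R.
Proof.
elim/ltn_ind: x => x IH; have [->|x0] := posnP x.
  by rewrite /psi big_geq // mulr0.
have xE : x = (odd x + (x./2 + x./2))%N by rewrite addnn odd_double_half.
have hlt : (x./2 < x)%N by rewrite ltn_half_double -addnn -[X in (X < _)%N]addn0 ltn_add2l.
have := IH _ hlt; have := psi_double x./2; move: (x./2) (odd x) xE => h o ->.
have h0 := ler0n R h; case: o; last by rewrite add0n natrD => h1 h2; nra.
move=> h1 h2; rewrite add1n {1}/psi big_nat_recr //= -/(psi _).
have h3 : vonMangoldt R (h + h).+1 <= (h + h)%:R.
  apply: le_trans (vonMangoldt_le R _) _.
  have := @le_ln1Dx R (h + h)%:R; rewrite nat1r; apply.
  by rewrite (lt_le_trans (ltrN10 R)).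
move: h1 h2 h3; rewrite -natr1 natrD.
move: (psi _) (psi _) (vonMangoldt _ _) => a b c.
by nra.
Qed.

(** Replacing [x %/ d] by [x / d] in Legendre's formula costs at most [psi x <= 4 x]; the two
    Stirling bounds do the rest. *)
Lemma mertens x : (0 < x)%N ->
  ln x%:R - 1 <= \sum_(1 <= d < x.+1) vonMangoldt R d / d%:R <= ln x%:R + 4.
Proof.
move=> x0; have x0' : 0 < x%:R :> R by rewrite ltr0n.
rewrite -(ler_pM2l x0') -[X in _ && X](ler_pM2l x0') mulr_sumr.
have h1 : lnfact x <= \sum_(1 <= d < x.+1) x%:R * (vonMangoldt R d / d%:R).
  rewrite lnfact_vonMangoldt; apply: ler_sum_nat => d /andP[d0 _].
  rewrite mulrCA ler_wpM2l ?vonMangoldt_ge0 // ler_pdivlMr ?ltr0n //.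
  by rewrite -natrM ler_nat leq_trunc_div.
have h2 : \sum_(1 <= d < x.+1) x%:R * (vonMangoldt R d / d%:R) <= lnfact x + psi x.
  rewrite lnfact_vonMangoldt /psi -big_split /=; apply: ler_sum_nat => d /andP[d0 _].
  rewrite mulrCA -[X in _ <= _ + X]mulr1 -mulrDr ler_wpM2l ?vonMangoldt_ge0 //.
  by rewrite ler_pdivrMr ?ltr0n // natr1 -natrM ler_nat ltnW // ltn_ceil.
have := lnfact_le x; have := lnfact_ge x; have := chebyshev x.
move: (\sum_(_ <= _ < _) _) (psi x) (lnfact x) h1 h2 => a b c h1 h2 h3 h4 h5.
by apply/andP; split; nra.
Qed.

Lemma sum_nonprime_vonMangoldt x :
  \sum_(1 <= d < x.+1 | ~~ prime d) vonMangoldt R d / d%:R <= 2.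
Proof.
have step1 : \sum_(1 <= d < x.+1 | ~~ prime d) vonMangoldt R d / d%:R <=
  \sum_(1 <= d < x.+1) \sum_(2 <= p < x.+1) \sum_(2 <= k < x.+1)
     (if d == (p ^ k)%N then ln p%:R / p%:R ^+ k else 0).
  rewrite big_mkcond; apply: ler_sum_nat => d /andP[d0 dx].
  have pos p k : 0 <= if d == (p ^ k)%N then ln p%:R / p%:R ^+ k else 0 :> R.
    by case: ifP => // _; rewrite mulr_ge0 ?ln_nat_ge0 // invr_ge0 exprn_ge0.
  have pos2 p : 0 <= \sum_(2 <= k < x.+1)
     (if d == (p ^ k)%N then ln p%:R / p%:R ^+ k else 0) :> R.
    by apply: sumr_ge0 => k _.
  case: ifPn => pd; last by apply: sumr_ge0 => p _.
  have [->|] := eqVneq (vonMangoldt R d) 0; first by rewrite mul0r sumr_ge0.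
  move=> /vonMangoldt_neq0; set p := pdiv d; set k := logn _ _ => -[pp k0 E ->].
  have k2 : (1 < k)%N.
    by case: k k0 E => [|[|k]] // _ E; rewrite E expn1 pp in pd.
  have pd' : (p <= d)%N by rewrite dvdn_leq // pdiv_dvd.
  have kd : (k <= d)%N by rewrite E ltnW // ltn_expl // prime_gt1.
  rewrite (bigD1_seq p) ?iota_uniq ?mem_index_iota ?prime_gt1 //=; last first.
    exact: leq_ltn_trans dx.
  apply: ler_wpDr; first by apply: sumr_ge0.
  rewrite (bigD1_seq k) ?iota_uniq ?mem_index_iota ?k2 //=; last first.
    exact: leq_ltn_trans dx.
  by rewrite -E eqxx -natrX -E lerDl sumr_ge0.
apply: le_trans step1 _; rewrite exchange_big_nat /=.
(* The geometric series over [k >= 2] is at most [ln p / (p (p - 1))]. Primality of [p] is dropped,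
   and a telescoping majorant with total at most 2 replaces this quotient. *)
have step2 p : (2 <= p)%N -> \sum_(1 <= d < x.+1) \sum_(2 <= k < x.+1)
     (if d == (p ^ k)%N then ln p%:R / p%:R ^+ k else 0) <=
   (ln p.-1%:R + 2) / p.-1%:R - (ln p%:R + 2) / p%:R :> R.
  move=> p2; rewrite exchange_big_nat /=.
  apply: (@le_trans _ _ (\sum_(2 <= k < x.+1) ln p%:R / p%:R ^+ k)).
    apply: ler_sum_nat => k _; rewrite -big_mkcond /=.
    case: (boolP ((p ^ k)%N \in index_iota 1 x.+1)) => h.
      rewrite (eq_bigl (pred1 (p ^ k)%N)) // -big_filter filter_pred1_uniq ?iota_uniq //.
      by rewrite big_seq1.
    rewrite big1_seq; first by rewrite mulr_ge0 ?ln_nat_ge0 // invr_ge0 exprn_ge0.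
    by move=> i /andP[/eqP -> i']; rewrite i' in h.
  rewrite -mulr_sumr; case: p p2 => // p; rewrite ltnS => p0 /=.
  have p0' : 0 < p%:R :> R by rewrite ltr0n.
  have nz := lt0r_neq0 p0'; have nz1 : p%:R + 1 != 0 :> R by rewrite natr1 pnatr_eq0.
  have geo : \sum_(2 <= k < x.+1) p.+1%:R ^- k <= (p%:R * p.+1%:R)^-1 :> R.
    have : \sum_(2 <= k < x.+1) p.+1%:R ^- k <= (p%:R * p.+1%:R)^-1 - p%:R^-1 * p.+1%:R ^- (maxn x 1) :> R.
      elim: x => [|[|y] IH].
      - by rewrite big_geq // expr1 invfM subrr.
      - by rewrite big_geq // expr1 invfM subrr.
      rewrite big_nat_recr //= (maxn_idPl _) //; move: IH; rewrite (maxn_idPl _) //.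
      rewrite (exprSr _ y.+1) !invfM.
      move: (p.+1%:R ^- y.+1) => u IH.
      apply: le_trans (lerD IH (lexx _)) _; rewrite -addrA lerD2l.
      suff -> : - (p%:R^-1 * u) + u / p.+1%:R = - (p%:R^-1 * (u / p.+1%:R)) by [].
        by rewrite -natr1; field; apply/andP; split; [exact: nz1|exact: nz].
    by move=> /le_trans; apply; rewrite gerBl mulr_ge0 // invr_ge0 ?exprn_ge0 // ltW.
  apply: le_trans (ler_wpM2l (ln_nat_ge0 _) geo) _.
  have h := ln_succ p0; rewrite ler_pdivrMr ?mulr_gt0 ?ltr0n //.
  suff h3 : ln p.+1%:R <= (ln p%:R + 2) * p.+1%:R - (ln p.+1%:R + 2) * p%:R :> R.
    apply: (le_trans h3); rewrite le_eqVlt; apply/orP; left; apply/eqP.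
    have fid (a b q : R) : q != 0 -> q + 1 != 0 ->
      (a + 2) * (q + 1) - (b + 2) * q = ((a + 2) / q - (b + 2) / (q + 1)) * (q * (q + 1)).
      by move=> q0 q1; field; rewrite ?q0 ?q1.
    by rewrite -[p.+1%:R]natr1; apply: fid; [exact: nz|exact: nz1].
  move: h; rewrite -[p.+1%:R]natr1; have := @ler_ln_nat p p.+1 (leqnSn p).
  have p1 : 1 <= p%:R :> R by rewrite ler1n.
  move: (ln (p%:R + 1)) (ln p%:R : R) => b a ab h.
  by nra.
apply: (le_trans (ler_sum_nat (fun p (hp : (2 <= p < x.+1)%N) => step2 p (proj1 (andP hp))))).
clear step2; case: x => [|x]; first by rewrite big_geq.
set S := \sum_(_ <= _ < _) _.
have -> : S = 2 - (ln x.+1%:R + 2) / x.+1%:R.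
  rewrite /S; elim: x {S} => [|x IH]; first by rewrite big_geq // ln1 add0r divr1 subrr.
  by rewrite big_nat_recr //= IH addrA subrK.
by rewrite gerBl mulr_ge0 ?addr_ge0 ?ln_nat_ge0.
Qed.

Lemma abel_bound (c b : nat -> R) (B : R) m :
  (forall k, `|\sum_(m <= n < m + k) c n| <= B) ->
  (forall k, 0 <= b (m + k)%N) ->
  (forall k, b (m + k).+1 <= b (m + k)%N) ->
  forall k, `|\sum_(m <= n < m + k) c n * b n| <= B * b m.
Proof.
move=> hc b0 bd.
have B0 : 0 <= B by apply: le_trans (hc 0%N).
case=> [|k]; first by rewrite addn0 big_geq // normr0 mulr_ge0 //; have := b0 0%N; rewrite addn0.
(* Subtracting the boundary term of the summation by parts makes the bound additive in [k]. *)
have : `|\sum_(m <= n < (m + k).+1) c n * b n - (\sum_(m <= n < (m + k).+1) c n) * b (m + k)%N|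
    <= B * (b m - b (m + k)%N).
  elim: k => [|k IH]; first by rewrite addn0 !big_nat1 subrr normr0 subrr mulr0.
  rewrite addnS ![\sum_(m <= n < (m + k).+2) _]big_nat_recr ?(leq_trans _ (leqnSn _)) ?leq_addr //=.
  set S := \sum_(_ <= _ < _) _; set C := \sum_(_ <= _ < _) _.
  have -> : S + c (m + k).+1 * b (m + k).+1 - (C + c (m + k).+1) * b (m + k).+1 =
     (S - C * b (m + k)%N) + C * (b (m + k)%N - b (m + k).+1) by ring.
  apply: le_trans (ler_normD _ _) _.
  have -> : B * (b m - b (m + k).+1) = B * (b m - b (m + k)%N) + B * (b (m + k)%N - b (m + k).+1).
    by ring.
  apply: lerD => //; rewrite normrM ler_pM //; first by rewrite /C -addnS.
  by rewrite ger0_norm // subr_ge0.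
rewrite addnS; set S := \sum_(_ <= _ < _) _; set C := \sum_(_ <= _ < _) _ => h.
have -> : S = (S - C * b (m + k)%N) + C * b (m + k)%N by ring.
apply: le_trans (ler_normD _ _) _.
have -> : B * b m = B * (b m - b (m + k)%N) + B * b (m + k)%N by ring.
apply: lerD => //; rewrite normrM (ger0_norm (b0 k)) ler_wpM2r //.
by rewrite /C -addnS.
Qed.

End Chebyshev.

(** * Limits along an ultrafilter *)

Definition ultra : set_system nat :=
  projT1 (cid (ultraFilterLemma eventually_filter)).

#[global] Instance ultra_ultra : UltraFilter ultra.
Proof. by rewrite /ultra; case: cid => G []. Qed.

Lemma ultra_oo : \oo `<=` ultra.
Proof. by rewrite /ultra; case: cid => G []. Qed.

Section Ulim.
Variable R : realType.
Implicit Types u v : nat -> R.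

Definition bnd u := exists C, forall n, `|u n| <= C.

(* Meaningful for bounded [u] only. *)
Definition ulim u : R := lim (u @ ultra).

Lemma bnd_ge0 u : bnd u -> exists2 C, 0 <= C & forall n, `|u n| <= C.
Proof. by case=> C h; exists C => //; apply: le_trans (h 0%N). Qed.

Lemma bnd_cst c : bnd (fun=> c).
Proof. by exists `|c|. Qed.

Lemma bndD u v : bnd u -> bnd v -> bnd (fun n => u n + v n).
Proof.
move=> [C h] [D k]; exists (C + D) => n.
by apply: le_trans (ler_normD _ _) _; exact: lerD.
Qed.

Lemma bndM u v : bnd u -> bnd v -> bnd (fun n => u n * v n).
Proof. by move=> [C h] [D k]; exists (C * D) => n; rewrite normrM ler_pM. Qed.

Lemma bndN u : bnd u -> bnd (fun n => - u n).
Proof. by move=> [C h]; exists C => n; rewrite normrN. Qed.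

Lemma bnd_sum I (r : seq I) (u : I -> nat -> R) :
  (forall i, bnd (u i)) -> bnd (fun n => \sum_(i <- r) u i n).
Proof.
move=> h; elim: r => [|i r IH].
  by exists 0 => n; rewrite big_nil normr0.
have := bndD (h i) IH; congr bnd; apply/funext => n; by rewrite big_cons.
Qed.

(** By compactness of [[-C, C]] the image ultrafilter has a cluster point, and an ultrafilter
    converges to each of its cluster points. *)
Lemma ulim_cvg u : bnd u -> u @ ultra --> ulim u.
Proof.
move=> [C h]; apply/cvg_ex.
have [] := @segment_compact R (- C) C (u @ ultra).
  by apply: nearW => n /=; rewrite in_itv /= -ler_norml.
move=> l [_ hl]; exists l => V Vl.
have [//|nV] := in_ultra_setVsetC (u @^-1` V) ultra_ultra.
have nV' : (u @ ultra) (~` V) by [].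
by have [x []] := hl _ _ nV' Vl.
Qed.

Lemma ulim_lim u l : u @ \oo --> l -> ulim u = l.
Proof.
move=> h; apply/cvg_lim => //; apply: cvg_trans h.
by move=> A; exact: ultra_oo.
Qed.

Lemma ulim_cst c : ulim (fun=> c) = c.
Proof. by apply: ulim_lim; exact: cvg_cst. Qed.

Lemma ulimD u v : bnd u -> bnd v -> ulim (fun n => u n + v n) = ulim u + ulim v.
Proof. by move=> hu hv; apply/cvg_lim => //; apply: cvgD; exact: ulim_cvg. Qed.

Lemma ulimM u v : bnd u -> bnd v -> ulim (fun n => u n * v n) = ulim u * ulim v.
Proof. by move=> hu hv; apply/cvg_lim => //; apply: cvgM; exact: ulim_cvg. Qed.

Lemma ulimZ c u : bnd u -> ulim (fun n => c * u n) = c * ulim u.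
Proof. by move=> hu; rewrite ulimM ?ulim_cst //; exact: bnd_cst. Qed.

Lemma ulimN u : bnd u -> ulim (fun n => - u n) = - ulim u.
Proof. by move=> hu; apply/cvg_lim => //; apply: cvgN; exact: ulim_cvg. Qed.

Lemma ulimB u v : bnd u -> bnd v -> ulim (fun n => u n - v n) = ulim u - ulim v.
Proof. by move=> hu hv; rewrite ulimD ?ulimN //; exact: bndN. Qed.

Lemma ulim_sum I (r : seq I) (u : I -> nat -> R) : (forall i, bnd (u i)) ->
  ulim (fun n => \sum_(i <- r) u i n) = \sum_(i <- r) ulim (u i).
Proof.
move=> h; elim: r => [|i r IH].
  by rewrite big_nil -[RHS](ulim_cst 0); congr ulim; apply/funext => n; rewrite big_nil.
rewrite big_cons -IH -ulimD //; last exact: bnd_sum.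
by congr ulim; apply/funext => n; rewrite big_cons.
Qed.

Lemma ulim_le u v : bnd u -> bnd v -> (\forall n \near \oo, u n <= v n) ->
  ulim u <= ulim v.
Proof.
move=> hu hv uv; apply: (ler_cvg_to (ulim_cvg hu) (ulim_cvg hv)).
exact: ultra_oo uv.
Qed.

Lemma ulim_eq u v : bnd u -> bnd v -> (fun n => u n - v n) @ \oo --> 0 ->
  ulim u = ulim v.
Proof.
by move=> hu hv h; apply/eqP; rewrite -subr_eq0 -ulimB // (ulim_lim h).
Qed.

Lemma ulim_norm u C : (forall n, `|u n| <= C) -> `|ulim u| <= C.
Proof.
move=> h; have hu : bnd u by exists C.
rewrite ler_norml -[X in - X](ulim_cst C) -ulimN; last exact: bnd_cst.
rewrite -[X in _ && (_ <= X)](ulim_cst C); apply/andP; split;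
  apply: ulim_le => //; try exact: bnd_cst; try exact/bndN/bnd_cst;
  by apply: nearW => n; have := h n; rewrite ler_norml => /andP[].
Qed.

End Ulim.

(** * Primes weighted by functions on residue classes *)

Lemma ler_dist_sum (R : realType) (m n : nat) (u v : nat -> R) :
  (forall i, (m <= i < n)%N -> `|u i| <= v i) ->
  `|\sum_(m <= i < n) u i| <= \sum_(m <= i < n) v i.
Proof.
by move=> h; apply: le_trans (ler_norm_sum _ _ _) _; exact: ler_sum_nat.
Qed.

(** The limit is [ulim u]; the rate survives letting [k] tend to infinity in the hypothesis. *)
Lemma cauchy_rate (R : realType) (u : nat -> R) (C : R) :
  (forall y k, `|u (y + k)%N - u y| <= C / y.+1%:R) ->
  exists l, forall y, `|l - u y| <= C / y.+1%:R.
Proof.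
move=> h; have bu : bnd u.
  exists (`|u 0%N| + C / 1%:R) => n; rewrite -lerBlDl.
  by apply: le_trans (h 0%N n); rewrite add0n lerB_dist.
exists (ulim u) => y; rewrite -[u y]ulim_cst -ulimB //; last exact: bnd_cst.
have bd : bnd (fun n => u n - u y) by apply/bndD/bndN/bnd_cst.
rewrite ler_norml -[X in - X](ulim_cst (C / _)) -ulimN; last exact: bnd_cst.
rewrite -[X in _ && (_ <= X)](ulim_cst (C / _)).
apply/andP; split; (apply: ulim_le => //; try exact: bnd_cst; try exact/bndN/bnd_cst);
  exists y => // n /= /subnKC <-; by have := h y (n - y)%N; rewrite ler_norml => /andP[].
Qed.

Section LogScale.
Variable R : realType.

(* The summand 1 keeps the normalisation nonzero for [x <= 1]. *)
Definition lx (x : nat) : R := ln x%:R + 1.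

Lemma lx_gt0 x : 0 < lx x.
Proof. by rewrite /lx ltr_wpDl ?ln_nat_ge0. Qed.

Lemma lx_oo (C : R) : \forall x \near \oo, C <= lx x.
Proof.
have [n hn] : exists n : nat, expR C <= n%:R.
  exists (Num.truncn (expR C)).+1; exact/ltW/truncnS_gt.
exists n => // x /= nx; rewrite /lx ler_wpDr //.
rewrite -[C]expRK ler_ln ?posrE ?expR_gt0 //.
  by apply: le_trans hn _; rewrite ler_nat.
by apply: lt_le_trans (expR_gt0 C) (le_trans hn _); rewrite ler_nat.
Qed.

Lemma lx_inv0 (C : R) : (fun x => C / lx x) @ \oo --> 0.
Proof.
apply/cvgrPdist_le => e e0; near=> x.
rewrite sub0r normrN normrM normfV (gtr0_norm (lx_gt0 x)) ler_pdivrMr ?lx_gt0 //.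
rewrite mulrC -ler_pdivrMr //.
by near: x; exact: lx_oo.
Unshelve. all: by end_near. Qed.

Lemma ulim_lx (u : nat -> R) (c C : R) :
  (forall x, `|u x - c * lx x| <= C) -> ulim (fun x => u x / lx x) = c.
Proof.
move=> h; apply: ulim_lim.
have -> : (fun x => u x / lx x) = (fun x => (u x - c * lx x) / lx x + c).
  by apply/funext => x; rewrite mulrBl mulfK ?subrK // gt_eqF // lx_gt0.
rewrite -[X in _ --> X]add0r; apply: cvgD; last exact: cvg_cst.
apply/norm_cvg0P; apply: (@squeeze_cvgr _ _ _ _ (fun=> 0) (fun x => C / lx x)).
- apply: nearW => x; rewrite normr_ge0 /= normrM normfV (gtr0_norm (lx_gt0 x)).
  by rewrite ler_wpM2r // invr_ge0 ltW // lx_gt0.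
- exact: cvg_cst.
- exact: lx_inv0.
Qed.

End LogScale.

(** * Densities of the residue classes modulo [w.+2] *)

Section Dirichlet.
Variables (R : realType) (w : nat).
Notation T := 'I_w.+2.
Implicit Types (phi F : T -> R) (g h : T).

Definition mangoldt_avg F (x : nat) : R :=
  \sum_(1 <= d < x.+1) vonMangoldt R d / d%:R * F d%:R.

Lemma mangoldt_avg_le F F' x : (forall h, F h <= F' h) ->
  mangoldt_avg F x <= mangoldt_avg F' x.
Proof.
move=> h; apply: ler_sum_nat => d _; rewrite ler_wpM2l //.
by rewrite mulr_ge0 ?vonMangoldt_ge0.
Qed.

Lemma mangoldt_avg_delta F x :
  mangoldt_avg F x = \sum_h F h * mangoldt_avg (fun g => (g == h)%:R) x.
Proof.
rewrite /mangoldt_avg; under [RHS]eq_bigr do rewrite mulr_sumr.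
rewrite exchange_big; apply: eq_bigr => d _ /=.
rewrite (bigD1 (d%:R : T)) //= eqxx mulr1 mulrC big1 ?addr0 // => h hd.
by rewrite eq_sym (negbTE hd) !mulr0.
Qed.

Lemma mangoldt_avg1 x : `|mangoldt_avg (fun=> 1) x - 1 * lx R x| <= 4.
Proof.
rewrite mul1r /mangoldt_avg; under eq_bigr do rewrite mulr1.
have [->|x0] := posnP x.
  by rewrite big_geq // /lx ln0 // !add0r normrN normr1 ler1n.
have /andP[h1 h2] := mertens R x0.
by rewrite ler_norml /lx; apply/andP; split; lra.
Qed.

(** This is [s h] of the overview. Only boundedness of the quotient is known here, hence the limit
    along the ultrafilter. *)
Definition dens h : R :=
  ulim (fun x => mangoldt_avg (fun g => (g == h)%:R) x / lx R x).

Lemma bnd_dens h : bnd (fun x => mangoldt_avg (fun g => (g == h)%:R) x / lx R x).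
Proof.
exists 5 => x; have l0 := lx_gt0 R x.
rewrite normrM normfV (gtr0_norm l0) ler_pdivrMr // ger0_norm; last first.
  by apply: sumr_ge0 => d _; rewrite !mulr_ge0 ?vonMangoldt_ge0.
apply: (@le_trans _ _ (mangoldt_avg (fun=> 1) x)).
  by apply: mangoldt_avg_le => g; rewrite lern1 leq_b1.
have := mangoldt_avg1 x; rewrite mul1r ler_norml => /andP[_].
by have : 1 <= lx R x by [rewrite /lx lerDr ln_nat_ge0]; nra.
Qed.

Lemma dens_ge0 h : 0 <= dens h.
Proof.
rewrite -[0](@ulim_cst R); apply: ulim_le; [exact: bnd_cst|exact: bnd_dens|].
apply: nearW => x; rewrite mulr_ge0 ?invr_ge0 ?(ltW (lx_gt0 _ _)) //.
by apply: sumr_ge0 => d _; rewrite !mulr_ge0 ?vonMangoldt_ge0.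
Qed.

(** Splitting [F] into indicators of classes turns any asymptotic [c ln x + O(1)] into a linear
    relation between the densities. *)
Lemma dens_sum F (c C : R) :
  (forall x, `|mangoldt_avg F x - c * lx R x| <= C) -> \sum_h dens h * F h = c.
Proof.
move=> /ulim_lx <-.
have -> : (fun x => mangoldt_avg F x / lx R x) = (fun x =>
   \sum_h F h * (mangoldt_avg (fun g => (g == h)%:R) x / lx R x)).
  apply/funext => x; rewrite mangoldt_avg_delta mulr_suml.
  by apply: eq_bigr => h _; rewrite mulrA.
rewrite ulim_sum; last first.
  by move=> h; apply: bndM; [exact: bnd_cst|exact: bnd_dens].
by apply: eq_bigr => h _; rewrite ulimZ; [rewrite -/(dens h) mulrC|exact: bnd_dens].
Qed.

Lemma sum_dens : \sum_h dens h = 1.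
Proof. by rewrite -(dens_sum mangoldt_avg1); apply: eq_bigr => h _; rewrite mulr1. Qed.

Lemma unit_nat d : ((d%:R : T) \is a GRing.unit) = coprime w.+2 d.
Proof. exact: (@unitZpE w.+2). Qed.

(** Higher prime powers contribute at most 2, and a prime in a non-unit class divides the modulus,
    so it is at most [w.+2]. The weighted sum thus stays bounded. *)
Lemma dens_nonunit h : h \isn't a GRing.unit -> dens h = 0.
Proof.
move=> hU; have := @dens_sum (fun g => (g == h)%:R) 0 (2 + \sum_(1 <= p < w.+3) ln p%:R).
have -> : \sum_g dens g * (g == h)%:R = dens h.
  rewrite (bigD1 h) //= eqxx mulr1 big1 ?addr0 // => g /negbTE ->.
  by rewrite mulr0.
apply=> x; rewrite mul0r subr0 ger0_norm; last first.
  by apply: sumr_ge0 => d _; rewrite !mulr_ge0 ?vonMangoldt_ge0.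
rewrite /mangoldt_avg (bigID (fun d => ~~ prime d)) /=; apply: lerD.
  apply: le_trans (sum_nonprime_vonMangoldt R x); apply: ler_sum => d _.
  by rewrite ler_piMr ?mulr_ge0 ?vonMangoldt_ge0 // lern1 leq_b1.
under eq_bigl do rewrite negbK.
have [xw|wx] := leqP x w.+2.
  rewrite [X in _ <= X](big_cat_nat (n := x.+1)) //=; apply: ler_wpDr.
    by apply: sumr_ge0 => p _; exact: ln_nat_ge0.
  rewrite big_mkcond; apply: ler_sum_nat => p /andP[p0 _]; case: ifP => [pp|_]; last exact: ln_nat_ge0.
  rewrite vonMangoldt_prime // -mulrA ler_piMr ?ln_nat_ge0 //.
  by rewrite mulr_ile1 ?invr_ge0 ?invf_le1 ?ltr0n ?ler1n ?lern1 ?leq_b1.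
rewrite (big_cat_nat (n := w.+3)) //=; last exact: ltnW.
rewrite [X in _ + X]big1_seq ?addr0; last first.
  move=> p /andP[pp]; rewrite mem_index_iota => /andP[wp _].
  case: eqP => [E|]; last by rewrite mulr0.
  move: hU; rewrite -E unit_nat coprime_sym prime_coprime // negbK => /dvdn_leq.
  by move=> /(_ isT); rewrite leqNgt wp.
rewrite big_mkcond; apply: ler_sum_nat => p /andP[p0 _]; case: ifP => [pp|_]; last exact: ln_nat_ge0.
rewrite vonMangoldt_prime // -mulrA ler_piMr ?ln_nat_ge0 //.
by rewrite mulr_ile1 ?invr_ge0 ?invf_le1 ?ltr0n ?ler1n ?lern1 ?leq_b1.
Qed.

Definition supp_mean0 phi :=
  (forall x, x \isn't a GRing.unit -> phi x = 0) /\ \sum_x phi x = 0.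

Lemma supp_mean0_mul phi g : supp_mean0 phi -> supp_mean0 (fun x => phi (g * x)).
Proof.
move=> [h1 h2]; split=> [x xU|].
  by apply: h1; rewrite unitrM negb_and xU orbT.
have [gU|gU] := boolP (g \is a GRing.unit).
  by move: h2; rewrite (reindex_inj (mulrI gU)).
by apply: big1 => x _; apply: h1; rewrite unitrM negb_and gU.
Qed.

(** Full periods sum to zero, so only one incomplete period remains. *)
Lemma sum_period phi N : supp_mean0 phi ->
  `|\sum_(0 <= n < N) phi n%:R| <= \sum_x `|phi x|.
Proof.
have pos n : 0 <= `|phi n%:R| by [].
have full : \sum_(0 <= n < w.+2) `|phi n%:R| = \sum_x `|phi x|.
  by rewrite big_mkord; apply: eq_bigr => i _; rewrite natr_Zp.
move=> [_ h2]; elim/ltn_ind: N => N IH; have [Nw|wN] := ltnP N w.+2.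
  rewrite -full; apply: le_trans (ler_norm_sum _ _ _) _.
  by rewrite [X in _ <= X](big_cat_nat (n := N)) ?(ltnW Nw) //= lerDl sumr_ge0.
rewrite (big_cat_nat (n := w.+2)) //= [X in X + _](_ : _ = 0); last first.
  by rewrite -[RHS]h2 big_mkord; apply: eq_bigr => i _; rewrite natr_Zp.
rewrite add0r -{1}[w.+2]add0n big_addn.
have := IH (N - w.+2)%N; rewrite ltn_subrL (leq_trans _ wN) // => /(_ isT).
apply: le_trans; rewrite le_eqVlt; apply/orP; left; apply/eqP; congr `|_|.
apply: eq_bigr => n _; rewrite natrD.
have -> : (w.+2)%:R = 0 :> T by apply: (@pchar_Zp w.+2).
by rewrite addr0.
Qed.

Lemma sum_period_tail phi : supp_mean0 phi -> exists2 B, 0 <= B &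
  forall g m k, `|\sum_(m <= n < m + k) phi (g * n%:R)| <= B.
Proof.
(* The factor 2 comes from a difference of two initial segments; summing over all [g] makes the
   constant independent of [g]. *)
move=> hphi; exists (\sum_g (\sum_x `|phi (g * x)|) * 2).
  by apply: sumr_ge0 => g _; rewrite mulr_ge0 // sumr_ge0.
move=> g m k; rewrite (bigD1 g) //=; apply: ler_wpDr.
  by apply: sumr_ge0 => h _; rewrite mulr_ge0 // sumr_ge0.
have hg := supp_mean0_mul g hphi.
have -> : \sum_(m <= n < m + k) phi (g * n%:R) =
   \sum_(0 <= n < m + k) phi (g * n%:R) - \sum_(0 <= n < m) phi (g * n%:R).
  by rewrite [X in X - _](big_cat_nat (n := m)) ?leq_addr //= addrC addrK.
apply: le_trans (ler_normB _ _) _; rewrite mulr_natr mulr2n.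
by apply: lerD; exact: sum_period hg.
Qed.

Definition Lsum phi g y : R := \sum_(1 <= m < y.+1) phi (g * m%:R) / m%:R.

(** Abel summation against the decreasing weights [1/n] gives the Cauchy rate. *)
Lemma Lsum_cvg phi : supp_mean0 phi -> exists (l : T -> R) (C : R),
  0 <= C /\ forall g y, `|l g - Lsum phi g y| <= C / y.+1%:R.
Proof.
move=> hphi; have [B B0 hB] := sum_period_tail hphi.
have H g : exists lg, forall y, `|lg - Lsum phi g y| <= B / y.+1%:R.
  apply: cauchy_rate => y k; rewrite /Lsum.
  rewrite (big_cat_nat (n := y.+1)) ?ltnS ?leq_addr //= addrAC subrr add0r -addSn.
  apply: (@abel_bound R (fun n => phi (g * n%:R)) (fun n => n%:R^-1)) => // j.
  by rewrite addSn lef_pV2 ?posrE ?ltr0n // ler_nat.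
have [l hl] := choice H.
by exists l, B.
Qed.

(* Since [ln = Lambda * 1], the bounded sum [sum_n phi(g n) ln n / n] equals
   [sum_d Lambda(d)/d * Lsum phi (g d) (x/d)]. *)
Lemma dens_Lsum phi l C : supp_mean0 phi -> 0 <= C ->
  (forall g y, `|l g - Lsum phi g y| <= C / y.+1%:R) ->
  forall g, \sum_h dens h * l (g * h) = 0.
Proof.
move=> hphi C0 hl g; have [B B0 hB] := sum_period_tail hphi.
apply: (@dens_sum (fun h => l (g * h)) 0 (B * (ln 1%:R + 1) / 1%:R + B / 1%:R + C * 4)).
move=> x; rewrite mul0r subr0.
pose D := \sum_(1 <= n < x.+1) phi (g * n%:R) * (ln n%:R / n%:R).
(* The weight [ln n / n] is not monotone from [n = 1] on, but [(ln n + 1) / n] is; Abel summation is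
   applied to it and to [1/n] separately. *)
have D1 : `|D| <= B * (ln 1%:R + 1) / 1%:R + B / 1%:R.
  have -> : D = \sum_(1 <= n < 1 + x) phi (g * n%:R) * ((ln n%:R + 1) / n%:R)
      - \sum_(1 <= n < 1 + x) phi (g * n%:R) * n%:R^-1.
    by rewrite -sumrB add1n; apply: eq_bigr => n _; ring.
  apply: le_trans (ler_normB _ _) _; apply: lerD.
    rewrite -mulrA; apply: (@abel_bound R _ (fun n => (ln n%:R + 1) / n%:R)) => // k.
      by rewrite mulr_ge0 // addr_ge0 ?ln_nat_ge0.
    rewrite add1n ler_pdivrMr ?ltr0n // mulrAC ler_pdivlMr ?ltr0n //.
    have := ln_succ R (ltn0Sn k); rewrite -[k.+2%:R]natr1.
    have : 0 <= ln k.+1%:R :> R by exact: ln_nat_ge0.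
    by move: (ln (k.+1%:R + 1)) (ln k.+1%:R : R) => a b *; nra.
  apply: (@abel_bound R _ (fun n => n%:R^-1)) => // k.
  by rewrite add1n lef_pV2 ?posrE ?ltr0n // ler_nat.
have D2 : D = \sum_(1 <= d < x.+1) vonMangoldt R d / d%:R * Lsum phi (g * d%:R) (x %/ d).
  have := dirichlet_sum x (fun d m => vonMangoldt R d * (phi (g * (d * m)%:R) / (d * m)%:R)).
  have -> : D = \sum_(1 <= n < x.+1) \sum_(d <- divisors n)
      vonMangoldt R d * (phi (g * (d * (n %/ d))%:R) / (d * (n %/ d))%:R).
    apply: eq_big_nat => n /andP[n0 _]; rewrite mulrCA -(sum_vonMangoldt R n0) mulr_suml.
    apply: eq_big_seq => d; rewrite -dvdn_divisors // => dn.
    by rewrite mulnC divnK.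
  move=> ->; apply: eq_big_nat => d /andP[d0 _]; rewrite /Lsum mulr_sumr.
  apply: eq_big_nat => m /andP[m0 _].
  have -> : g * (d * m)%:R = g * d%:R * m%:R by rewrite natrM mulrA.
  by rewrite natrM invfM; ring.
have -> : mangoldt_avg (fun h => l (g * h)) x = D + \sum_(1 <= d < x.+1)
    vonMangoldt R d / d%:R * (l (g * d%:R) - Lsum phi (g * d%:R) (x %/ d)).
  by rewrite D2 -big_split; apply: eq_bigr => d _ /=; ring.
apply: le_trans (ler_normD _ _) _; apply: lerD => //.
have [->|x0] := posnP x; first by rewrite big_geq // normr0 mulr_ge0.
have x0' : 0 < x%:R :> R by rewrite ltr0n.
(* The truncation error [C / (x %/ d + 1)] is at most [C d / x], which cancels the [1/d] and leaves
   [C psi x / x <= 4 C]. *)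
apply: (@le_trans _ _ (\sum_(1 <= d < x.+1) vonMangoldt R d * (C / x%:R))).
  apply: ler_dist_sum => d /andP[d0 _].
  rewrite normrM ger0_norm ?mulr_ge0 ?vonMangoldt_ge0 // -mulrA.
  rewrite ler_wpM2l ?vonMangoldt_ge0 //; apply: le_trans (ler_wpM2l _ (hl _ _)) _ => //.
  rewrite mulrCA -invfM ler_wpM2l // lef_pV2 ?posrE ?mulr_gt0 ?ltr0n //.
  by rewrite -natrM ler_nat mulnC ltnW // ltn_ceil.
rewrite -mulr_suml -/(psi R x) mulrCA ler_wpM2l // ler_pdivrMr //.
exact: chebyshev.
Qed.

(* By [sum_(d | n) mu(d) ln(x/d) = Lambda(n) + [n = 1] ln x]. *)
Lemma dens_Lsum0 phi C : 0 <= C -> (forall g y, `|Lsum phi g y| <= C / y.+1%:R) ->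
  forall g, \sum_h dens h * phi (g * h) = - phi g.
Proof.
move=> C0 hl g.
apply: (@dens_sum (fun h => phi (g * h)) (- phi g) (C + `|phi g|)) => x.
have [->|x0] := posnP x.
  rewrite /mangoldt_avg big_geq // /lx ln0 // !add0r mulr1 opprK.
  by rewrite lerDr.
have x0' : 0 < x%:R :> R by rewrite ltr0n.
pose Q := \sum_(1 <= d < x.+1) mobius R d * (ln x%:R - ln d%:R) / d%:R * Lsum phi (g * d%:R) (x %/ d).
have Q1 : `|Q| <= C.
  (* The same cancellation leaves [C / x] times [\sum_(d <= x) ln (x/d)], that is [x ln x - ln x!],
     at most [x] by Stirling. *)
  apply: (@le_trans _ _ (\sum_(1 <= d < x.+1) (ln x%:R - ln d%:R) * (C / x%:R))).
    apply: ler_dist_sum => d /andP[d0 dx]; rewrite ltnS in dx.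
    have dl : 0 <= ln x%:R - ln d%:R :> R by rewrite subr_ge0 ler_ln_nat.
    rewrite -!mulrA normrM -[X in _ <= X]mul1r; apply: ler_pM => //.
      exact: mobius_bound.
    rewrite normrM ger0_norm // ler_wpM2l // normrM ger0_norm //.
    apply: le_trans (ler_wpM2l _ (hl _ _)) _ => //.
    rewrite mulrCA -invfM ler_wpM2l // lef_pV2 ?posrE ?mulr_gt0 ?ltr0n //.
    by rewrite -natrM ler_nat mulnC ltnW // ltn_ceil.
  rewrite -mulr_suml sumrB sumr_const_nat subSS subn0 -/(lnfact R x).
  rewrite mulrCA -[X in _ <= X]mulr1 ler_wpM2l // ler_pdivrMr // mul1r.
  by have := lnfact_ge R x; rewrite -mulr_natl; lra.
have Q2 : Q = phi g * ln x%:R + mangoldt_avg (fun h => phi (g * h)) x.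
  have := dirichlet_sum x (fun d m => mobius R d * (ln x%:R - ln d%:R) * (phi (g * (d * m)%:R) / (d * m)%:R)).
  have -> : \sum_(1 <= n < x.+1) \sum_(d <- divisors n)
      mobius R d * (ln x%:R - ln d%:R) * (phi (g * (d * (n %/ d))%:R) / (d * (n %/ d))%:R)
     = \sum_(1 <= n < x.+1) ((n == 1%N)%:R * ln x%:R + vonMangoldt R n) * (phi (g * n%:R) / n%:R).
    apply: eq_big_nat => n /andP[n0 _].
    rewrite -(sum_mobius R n0) -[vonMangoldt R n]opprK -(sum_mobius_ln R n0).
    rewrite mulr_suml -sumrB mulr_suml.
    apply: eq_big_seq => d; rewrite -dvdn_divisors // => dn.
    by rewrite [(d * _)%N]mulnC divnK // mulrBr.
  move=> E; rewrite /Q; transitivity (\sum_(1 <= n < x.+1)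
      ((n == 1%N)%:R * ln x%:R + vonMangoldt R n) * (phi (g * n%:R) / n%:R)).
    rewrite E; apply: eq_big_nat => d /andP[d0 _]; rewrite /Lsum mulr_sumr.
    apply: eq_big_nat => m /andP[m0 _].
    have -> : g * (d * m)%:R = g * d%:R * m%:R by rewrite natrM mulrA.
    by rewrite natrM invfM; ring.
  under eq_bigr do rewrite mulrDl; rewrite big_split /=; congr (_ + _).
    have g1 : g * 1%:R = g by exact: mulr1.
    rewrite big_ltn // eqxx g1 big1_seq.
      by rewrite addr0 mul1r divr1 mulrC.
    by move=> i; rewrite mem_index_iota => /andP[_ /andP[i1 _]]; rewrite gtn_eqF // !mul0r.
  by apply: eq_bigr => d _; ring.
have -> : mangoldt_avg (fun h => phi (g * h)) x - - phi g * lx R x = Q + phi g.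
  by rewrite Q2 /lx; ring.
by apply: le_trans (ler_normD _ _) _; rewrite lerD2r.
Qed.

End Dirichlet.

(** * Non-vanishing for real characters *)

Section RealCharacter.
Variable R : realType.

Lemma bernoulli_le (y : R) n : 0 <= y <= 1 -> 1 - y ^+ n <= n%:R * (1 - y).
Proof.
move=> /andP[y0 y1]; elim: n => [|n IH]; first by rewrite expr0 subrr mul0r.
rewrite exprS -natr1 mulrDl mul1r; have := exprn_ile1 n y0 y1; have := exprn_ge0 n y0.
by move: (y ^+ n) IH => u; nra.
Qed.

(** The AM-GM inequality for the powers [z^0, ..., z^n] of [z = y^2], whose geometric mean is
    [y^n]. *)
Lemma geometric_ge (y : R) n : 0 <= y <= 1 ->
  n.+1%:R * y ^+ n <= \sum_(i < n.+1) (y ^+ 2) ^+ i.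
Proof.
move=> hy; have /andP[y0 y1] := hy; elim: n => [|n IH].
  by rewrite big_ord1 !expr0 mulr1.
rewrite big_ord_recr /=; apply: le_trans (lerD IH (lexx _)).
have := bernoulli_le n.+1 hy; have := exprn_ge0 n y0.
have -> : y ^+ 2 ^+ n.+1 = y ^+ n * y * (y ^+ n * y) by rewrite exprAC expr2 -exprSr.
rewrite -[n.+2%:R]natr1 [y ^+ n.+1]exprSr.
have u1 := exprn_ile1 n y0 y1; move: (y ^+ n) (n.+1%:R : R) u1 => u N u1 u0 h.
have : 0 <= u * (N * (1 - y) - (1 - u * y)) by rewrite mulr_ge0 // subr_ge0.
have : 0 <= u * ((1 - u * y) * (1 - y)).
  by rewrite !mulr_ge0 // subr_ge0 // mulr_ile1.
by nra.
Qed.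

Section Lambert.
Variables (y : R) (hy : 0 < y < 1).
Let z := y ^+ 2.

Lemma lambert_z : 0 < z < 1.
Proof.
by case/andP: hy => y0 y1; rewrite /z exprn_gt0 //= exprn_ilt1 // ltW.
Qed.

Let z0 : 0 < z. Proof. by case/andP: lambert_z. Qed.
Let z1 : z < 1. Proof. by case/andP: lambert_z. Qed.

(** The difference of the coefficients of [c d] in the two series compared as [z -> 1]. Taking
    [z = y^2] makes the half-integral powers of [z] available. *)
Definition lambert_coef (d : nat) : R := (d%:R * (1 - z))^-1 - z ^+ d / (1 - z ^+ d).

Let G d := \sum_(i < d) z ^+ i.

Let G_gt0 d : 0 < G d.+1.
Proof.
apply: lt_le_trans (geometric_ge d _); first by rewrite mulr_gt0 ?exprn_gt0 //; case/andP: hy.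
by case/andP: hy => *; rewrite !ltW.
Qed.

Let zG d : 1 - z ^+ d = (1 - z) * G d.
Proof. by rewrite -opprB subrX1 -mulNr opprB. Qed.

Let coefE d : lambert_coef d.+1 = (d.+1%:R^-1 - z ^+ d.+1 / G d.+1) / (1 - z).
Proof.
rewrite /lambert_coef zG !invfM; ring.
Qed.

Lemma lambert_coef1 : lambert_coef 1 = 1.
Proof.
rewrite coefE /G big_ord1 expr0 expr1 divr1 invr1 divff //.
by rewrite subr_eq0 gt_eqF.
Qed.

Lemma lambert_coef_ge0 d : 0 <= lambert_coef d.+1.
Proof.
rewrite coefE mulr_ge0 ?invr_ge0 ?subr_ge0 ?(ltW z1) //.
rewrite ler_pdivrMr // mulrC ler_pdivlMr ?ltr0n // mulrC.
case/andP: hy => y0 y1; have hy' : 0 <= y <= 1 by rewrite !ltW.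
apply: le_trans (geometric_ge d hy'); rewrite ler_wpM2l //.
by rewrite /z -exprM ler_wiXn2l ?ltW //; lia.
Qed.

(* Reduces to the AM-GM bound [geometric_ge] for the two geometric sums. *)
Lemma lambert_coef_dec d : lambert_coef d.+2 <= lambert_coef d.+1.
Proof.
rewrite !coefE ler_pM2r ?invr_gt0 ?subr_gt0 //.
case/andP: hy => y0 y1; have hy' : 0 <= y <= 1 by rewrite !ltW.
have g1 := geometric_ge d hy'; have g2 := geometric_ge d.+1 hy'.
rewrite -/z -/(G _) in g1 g2.
(* The product of the two AM-GM bounds has the power [y^(2d+1)], at least [z^(d+1)]. This is the
   sign of the numerator of the difference below. *)
have h : d.+1%:R * d.+2%:R * z ^+ d.+1 <= G d.+1 * G d.+2.
  apply: (@le_trans _ _ (d.+1%:R * y ^+ d * (d.+2%:R * y ^+ d.+1))).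
    have -> : d.+1%:R * y ^+ d * (d.+2%:R * y ^+ d.+1) = d.+1%:R * d.+2%:R * (y ^+ d * y ^+ d.+1).
      by ring.
    rewrite ler_wpM2l ?mulr_ge0 // -exprD /z -exprM ler_wiXn2l ?ltW //; lia.
  by apply: ler_pM => //; rewrite mulr_ge0 // exprn_ge0 // ltW.
have GS : G d.+2 = G d.+1 + z ^+ d.+1 by rewrite /G big_ord_recr.
have zz : z * G d.+1 = G d.+2 - 1.
  rewrite /G [in RHS]big_ord_recl expr0 addrAC subrr add0r mulr_sumr.
  by apply: eq_bigr => i _; rewrite -exprS.
rewrite -subr_ge0.
have G1 := G_gt0 d; have G2 := G_gt0 d.+1.
have -> : d.+1%:R^-1 - z ^+ d.+1 / G d.+1 - (d.+2%:R^-1 - z ^+ d.+2 / G d.+2)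
   = (G d.+1 * G d.+2 - d.+1%:R * d.+2%:R * z ^+ d.+1) / (d.+1%:R * d.+2%:R * G d.+1 * G d.+2).
  have e1 : d.+1%:R != 0 :> R by rewrite pnatr_eq0.
  have e2 : d.+2%:R = d.+1%:R + 1 :> R by rewrite natr1.
  have e3 : d.+1%:R + 1 != 0 :> R by rewrite -e2 pnatr_eq0.
  have e4 := lt0r_neq0 G1; have e5 := lt0r_neq0 G2.
  have e6 : z ^+ d.+2 = z * z ^+ d.+1 by rewrite exprS.
  rewrite e2 e6; move: zz e1 e3 e4 e5; clear; move: (G d.+1) (G d.+2) (d.+1%:R : R) (z ^+ d.+1).
  move=> a b N Z zz e1 e3 e4 e5.
  have -> : z * Z / b = Z * (b - 1) / (a * b).
    by rewrite -zz; field; rewrite e4 e5.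
  have -> : Z / a = Z * b / (a * b) by field; rewrite e4 e5.
  by field; rewrite e1 e3 e4 e5.
by rewrite divr_ge0 ?subr_ge0 // !mulr_ge0 ?ltW.
Qed.

End Lambert.

Variables (c : nat -> R) (B : R).
Hypothesis c1 : c 1%N = 1.
Hypothesis cM : forall m n, c (m * n)%N = c m * c n.
Hypothesis c_val : forall n, [\/ c n = 0, c n = 1 | c n = -1].
Hypothesis c_sum : forall m k, `|\sum_(m <= n < m + k) c n| <= B.

(** The coefficients of the Lambert series [\sum_d c d z^d / (1 - z^d)]. *)
Definition chi_div (n : nat) : R := \sum_(d <- divisors n) c d.

Let cX m n : c (m ^ n)%N = c m ^+ n.
Proof. by elim: n => [|n IH]; rewrite ?expn0 ?expr0 // expnS cM IH exprS. Qed.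

(** For [c p] equal to 0, 1 or -1 the sum is 1, [a + 1], or the indicator of even [a]. *)
Lemma geo_ge p a : 0 <= \sum_(0 <= i < a.+1) c (p ^ i)%N /\
  (~~ odd a -> 1 <= \sum_(0 <= i < a.+1) c (p ^ i)%N).
Proof.
under eq_bigr do rewrite cX.
have : \sum_(0 <= i < a.+1) c p ^+ i = if c p == 0 then 1 else if c p == 1 then a.+1%:R else (~~ odd a)%:R.
  elim: a => [|a IH].
    by rewrite big_nat1 expr0; case: ifP => // _; case: ifP.
  rewrite big_nat_recr //= IH; case: (c_val p) => ->.
  - by rewrite eqxx expr0n addr0.
  - by rewrite oner_eq0 eqxx expr1n natr1.
  - rewrite oppr_eq0 oner_eq0; have -> : (-1 == 1 :> R) = false by apply/eqP; lra.
    by rewrite -signr_odd /=; case: (odd a) => /=; rewrite ?expr0 ?expr1 ?add0r ?subrr.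
move=> ->; case: ifP => _; first by [].
case: ifP => _; first by rewrite ler0n ler1n.
by split=> // ->.
Qed.

Lemma chi_div_pfactor p a m : prime p -> ~~ (p %| m)%N -> (0 < m)%N ->
  chi_div (p ^ a * m) = (\sum_(0 <= i < a.+1) c (p ^ i)%N) * chi_div m.
Proof.
move=> pp pm m0; rewrite /chi_div divisors_pfactor // mulr_suml.
apply: eq_bigr => i _; rewrite mulr_sumr; apply: eq_bigr => e _; exact: cM.
Qed.

Lemma chi_div_ge0 n : (0 < n)%N -> 0 <= chi_div n.
Proof.
move: n; apply: pfactor_ind; first by rewrite /chi_div big_seq1 c1.
move=> p a m pp a0 pm m0 _ IH; rewrite chi_div_pfactor // mulr_ge0 //.
by have [] := geo_ge p a.
Qed.

Lemma chi_div_sq k : (0 < k)%N -> 1 <= chi_div (k * k).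
Proof.
move: k; apply: pfactor_ind; first by rewrite /chi_div big_seq1 c1.
move=> p a m pp a0 pm m0 _ IH.
have -> : (p ^ a * m * (p ^ a * m) = p ^ (a + a) * (m * m))%N by rewrite expnD; ring.
rewrite chi_div_pfactor //; last first.
- by rewrite muln_gt0 m0.
- by rewrite Euclid_dvdM // negb_or pm.
have [_ h] := geo_ge p (a + a).
by rewrite -[1]mulr1 ler_pM // h // addnn odd_double.
Qed.

(** All coefficients are nonnegative, and only the squares, with coefficient at least 1, are
    kept. *)
Lemma chi_div_lower K N (z : R) : (K * K <= N)%N -> 0 <= z ->
  \sum_(1 <= k < K.+1) z ^+ (k * k) <= \sum_(1 <= n < N.+1) chi_div n * z ^+ n.
Proof.
move=> KN z0.
have -> : \sum_(1 <= k < K.+1) z ^+ (k * k) =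
   \sum_(1 <= n < N.+1) (\sum_(1 <= k < K.+1) (n == k * k)%N%:R) * z ^+ n.
  under [RHS]eq_bigr do rewrite mulr_suml.
  rewrite exchange_big_nat /=; apply: eq_big_nat => k /andP[k0 kK].
  rewrite (bigD1_seq (k * k)%N) ?iota_uniq //=; last first.
    rewrite mem_index_iota muln_gt0 k0 ltnS (leq_trans _ KN) //.
    by apply: leq_mul.
  rewrite eqxx mul1r big1 ?addr0 // => n /negbTE ->.
  by rewrite mul0r.
apply: ler_sum_nat => n /andP[n0 nN]; rewrite ler_wpM2r ?exprn_ge0 //.
have [/hasP[k]|/hasPn h] := boolP (has (fun k => n == k * k)%N (index_iota 1 K.+1)).
  rewrite mem_index_iota => kK /eqP nk.
  rewrite (bigD1_seq k) ?iota_uniq ?mem_index_iota //= nk eqxx big1 ?addr0.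
    by apply: chi_div_sq; case/andP: kK.
  move=> j jk; case: eqP => // /eqP.
  by rewrite mulnn mulnn eqn_sqr eq_sym (negbTE jk).
rewrite big1_seq ?chi_div_ge0 // => k /andP[_ /h].
by move=> /negbTE ->.
Qed.

(** The three terms are the partial sum at 1, the Abel bound for coefficients decreasing from
    [lambert_coef 1 = 1], and the cost of cutting the geometric series at [d m <= N]. *)
Lemma lambert_sum (y : R) (N : nat) : 0 < y < 1 ->
  \sum_(1 <= n < N.+1) chi_div n * (y ^+ 2) ^+ n <=
    `|\sum_(1 <= n < N.+1) c n / n%:R| / (1 - y ^+ 2) + B
      + N%:R * (y ^+ 2) ^+ N / (1 - y ^+ 2).
Proof.
move=> hy; set z := y ^+ 2; have /andP[z0 z1] := lambert_z hy; rewrite -/z in z0 z1.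
have z1' : 0 < 1 - z by rewrite subr_gt0.
have zn d : (0 < d)%N -> 0 < 1 - z ^+ d.
  by move=> d0; rewrite subr_gt0 exprn_ilt1 ?ltW // -lt0n.
have geo q m : q != 1 -> \sum_(1 <= i < m.+1) q ^+ i = (q - q ^+ m.+1) / (1 - q) :> R.
  move=> q1; have q1' : 1 - q != 0 by rewrite subr_eq0 eq_sym.
  elim: m => [|m IH]; first by rewrite big_geq // expr1 subrr mul0r.
  rewrite big_nat_recr //= IH [in RHS]exprSr; move: (q ^+ m.+1) => u.
  by field.
have -> : \sum_(1 <= n < N.+1) chi_div n * z ^+ n =
   \sum_(1 <= d < N.+1) \sum_(1 <= m < (N %/ d).+1) c d * z ^+ (d * m).
  rewrite -(dirichlet_sum N (fun d m => c d * z ^+ (d * m))).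
  apply: eq_big_nat => n /andP[n0 _]; rewrite /chi_div mulr_suml.
  by apply: eq_big_seq => d; rewrite -dvdn_divisors // => dn; rewrite mulnC divnK.
have -> : \sum_(1 <= d < N.+1) \sum_(1 <= m < (N %/ d).+1) c d * z ^+ (d * m) =
  (\sum_(1 <= n < N.+1) c n / n%:R) / (1 - z)
  - \sum_(1 <= d < 1 + N) c d * lambert_coef y d
  - \sum_(1 <= d < N.+1) c d * z ^+ (d * (N %/ d).+1) / (1 - z ^+ d).
  rewrite add1n mulr_suml -!sumrB; apply: eq_big_nat => d /andP[d0 _].
  under eq_bigr do rewrite exprM.
  rewrite -mulr_sumr geo; last by rewrite lt_eqF // -subr_gt0 zn.
  rewrite /lambert_coef -/z exprM invfM; ring.
apply: lerD; last first.
  apply: le_trans (ler_norm _) _; rewrite normrN.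
  have -> : N%:R * z ^+ N / (1 - z) = \sum_(1 <= d < N.+1) z ^+ N / (1 - z).
    by rewrite sumr_const_nat subSS subn0 -[RHS]mulr_natl mulrA.
  apply: ler_dist_sum => d /andP[d0 dN].
  rewrite !normrM normfV (gtr0_norm (zn _ d0)) (ger0_norm (exprn_ge0 _ (ltW z0))) -mulrA.
  have hc : `|c d| <= 1.
    by case: (c_val d) => ->; rewrite ?normr0 ?normrN ?normr1.
  have hz : z ^+ (d * (N %/ d).+1) <= z ^+ N.
    by rewrite ler_wiXn2l ?ltW // mulnC ltnW // ltn_ceil.
  have zp n : 0 <= z ^+ n by rewrite exprn_ge0 // ltW.
  have zi : 0 <= (1 - z ^+ d)^-1 by rewrite invr_ge0 ltW // zn.
  rewrite -[X in _ <= X]mul1r; apply: ler_pM => //; first exact: mulr_ge0.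
  apply: ler_pM => //.
  rewrite lef_pV2 ?posrE ?zn // lerD2l lerN2.
  by case: d d0 {dN hc hz zi} => // d _; rewrite exprS ger_pMr // exprn_ile1 ?ltW.
apply: lerD; first by rewrite ler_wpM2r ?invr_ge0 ?ler_norm ?ltW.
apply: le_trans (ler_norm _) _; rewrite normrN -[X in _ <= X]mulr1 -(lambert_coef1 hy).
apply: abel_bound => // k; rewrite add1n; first exact: lambert_coef_ge0.
exact: lambert_coef_dec.
Qed.

(** Near [z = 1] the squares make the Lambert sum exceed any bound, whereas a vanishing value at 1
    would keep it below [B + 1]. *)
Lemma L1_neq0 : ~ (fun N => \sum_(1 <= n < N.+1) c n / n%:R) @ \oo --> 0.
Proof.
move=> hL; have B0 : 0 <= B by apply: le_trans (c_sum 0 0).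
have [K hK] : exists K : nat, 2 * (B + 1) < K%:R.
  by exists (Num.truncn (2 * (B + 1))).+1; exact: truncnS_gt.
have K0 : (0 < K)%N by rewrite -(ltr0n R); lra.
(* With [z = exp (-2a)] every [k <= K] has [z^(k^2) >= 1 - 2 a K^2 = 1/2], so the [K] squares
   contribute more than [B + 1]. *)
pose a : R := (4 * (K * K)%:R)^-1.
have KK0 : 0 < (K * K)%:R :> R by rewrite ltr0n muln_gt0 K0.
have a0 : 0 < a by rewrite invr_gt0 mulr_gt0.
pose y := expR (- a); have hy : 0 < y < 1.
  by rewrite expR_gt0 expR_lt1 oppr_lt0.
have /andP[z0 z1] := lambert_z hy.
have yz n : (y ^+ 2) ^+ n = expR (- (2 * a * n%:R)).
  by rewrite /y -exprM -expRM_natl natrM; congr expR; ring.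
have low : B + 1 < \sum_(1 <= k < K.+1) (y ^+ 2) ^+ (k * k).
  apply: (@lt_le_trans _ _ (\sum_(1 <= k < K.+1) 2^-1)).
    by rewrite sumr_const_nat subSS subn0 -mulr_natl; lra.
  apply: ler_sum_nat => k /andP[k0 kK]; rewrite yz.
  apply: le_trans (expR_ge1Dx _).
  have : (k * k)%:R <= (K * K)%:R :> R by rewrite ler_nat leq_mul.
  have aK : a * (K * K)%:R = 4^-1 by rewrite /a invfM -mulrA mulVf ?gt_eqF // mulr1.
  by rewrite -(ler_pM2l a0) aK => h; lra.
have z1' : 0 < 1 - y ^+ 2 by rewrite subr_gt0.
(* Makes the two error terms of [lambert_sum], divided by [1 - z], at most [1/2] each. *)
pose e := (1 - y ^+ 2) / 2; have e0 : 0 < e by rewrite divr_gt0.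
have ev1 : \forall N \near \oo, `|\sum_(1 <= n < N.+1) c n / n%:R| <= e.
  by move/cvgrPdist_le: hL => /(_ e e0); apply: filterS => N; rewrite sub0r normrN.
have ev2 : \forall N \near \oo, N%:R * (y ^+ 2) ^+ N <= e.
  exists (Num.truncn (2 / ((2 * a) ^+ 2 * e))).+2 => // N /= hN.
  have N0 : 0 < N%:R :> R by rewrite ltr0n (leq_trans _ hN).
  have aN : 0 <= 2 * a * N%:R by rewrite !mulr_ge0 ?ltW.
  have h := @expR_ge1Dxn R (2 * a * N%:R) 1 aN.
  rewrite yz expRN ler_pdivrMr ?expR_gt0 // mulrC.
  have h2 : (2 * a * N%:R) ^+ 2 / 2 <= expR (2 * a * N%:R).
    by apply: le_trans h; rewrite lerDr.
  rewrite -ler_pdivrMr //; apply: le_trans h2.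
  have : 2 / ((2 * a) ^+ 2 * e) <= N%:R.
    by apply: le_trans (ltW (truncnS_gt _)) _; rewrite ler_nat ltnW.
  rewrite ler_pdivrMr ?mulr_gt0 ?exprn_gt0 // ?mulr_gt0 // => h3.
  rewrite ler_pdivrMr // exprMn [N%:R ^+ 2]expr2.
  by move: ((2 * a) ^+ 2) (N%:R : R) N0 h3 => A M M0; nra.
have [N [[h1 h2] h3]] := filter_ex (filterI (filterI ev1 ev2) (nbhs_infty_ge (K * K))).
have := lambert_sum N hy; have := chi_div_lower h3 (ltW z0).
have : `|\sum_(1 <= n < N.+1) c n / n%:R| / (1 - y ^+ 2) <= 2^-1.
  by rewrite ler_pdivrMr // [2^-1 * _]mulrC.
have : N%:R * (y ^+ 2) ^+ N / (1 - y ^+ 2) <= 2^-1.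
  by rewrite ler_pdivrMr // [2^-1 * _]mulrC.
move: low => /=; lra.
Qed.

End RealCharacter.

(** * Divergence of the sum of 1/p over primes p = 1 mod W *)

Section Rigidity.
Variables (R : realType) (T : finComUnitRingType).
Variables (s chi : T -> R) (c : R).
Hypothesis c_card : c = \sum_(h : T | h \is a GRing.unit) 1.
Hypothesis s_ge0 : forall h, 0 <= s h.
Hypothesis s_sum : \sum_h s h = 1.
Hypothesis s_unit : forall h, h \isn't a GRing.unit -> s h = 0.
Hypothesis chi0 : forall g, g \isn't a GRing.unit -> chi g = 0.
Hypothesis chiE : forall g, g \is a GRing.unit -> chi g = 1 - c * s g^-1.
Hypothesis chi_s : forall g, \sum_h s h * chi (g * h) = - chi g.

Let c_gt0 : 0 < c.
Proof. by rewrite c_card (bigD1 1) ?unitr1 //= ltr_wpDr // sumr_ge0. Qed.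

(** The upper bound is [s >= 0] in [chiE]; the lower one follows because [- chi g] is an average of
    values of [chi] with weights [s]. *)
Let chi_le1 g : `|chi g| <= 1.
Proof.
have le1 h : chi h <= 1.
  have [hU|hU] := boolP (h \is a GRing.unit); last by rewrite chi0.
  by rewrite chiE // gerBl mulr_ge0 // ltW.
rewrite ler_norml le1 andbT lerNl -chi_s -s_sum.
by apply: ler_sum => h _; rewrite -[X in _ <= X]mulr1 ler_wpM2l.
Qed.

Let sum_unitV (F : T -> R) :
  \sum_(h | h \is a GRing.unit) F h^-1 = \sum_(h | h \is a GRing.unit) F h.
Proof.
rewrite [RHS](reindex_inj (@invr_inj T)); apply: eq_bigl => h.
by rewrite unitrV.
Qed.

Let s_unit_sum (F : T -> R) :
  \sum_h s h * F h = \sum_(h | h \is a GRing.unit) s h * F h.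
Proof.
rewrite (bigID (fun h => h \is a GRing.unit)) /= [X in _ + X]big1 ?addr0 // => h hU.
by rewrite s_unit // mul0r.
Qed.

Let chi_sum : \sum_(h | h \is a GRing.unit) chi h = 0.
Proof.
rewrite (eq_bigr (fun h => 1 - c * s h^-1)); last by move=> h; exact: chiE.
rewrite sumrB -c_card -mulr_sumr (sum_unitV s).
have -> : \sum_(h | h \is a GRing.unit) s h = 1.
  rewrite -s_sum [RHS](bigID (fun h => h \is a GRing.unit)) /=.
  by rewrite [X in _ + X]big1 ?addr0.
by rewrite mulr1 subrr.
Qed.

Let sE h : h \is a GRing.unit -> c * s h = 1 - chi h^-1.
Proof. by move=> hU; rewrite chiE ?unitrV // invrK opprB addrC subrK. Qed.

(** Substitute [c * s h = 1 - chi h^-1] in [chi_s]; the constant part drops out because [chi] sums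
    to zero over the units. *)
Let chi_conv g : c * chi g = \sum_(h | h \is a GRing.unit) chi h^-1 * chi (g * h).
Proof.
have [gU|gU] := boolP (g \is a GRing.unit); last first.
  rewrite chi0 // mulr0 big1 // => h _.
  by rewrite (chi0 (g := g * h)) ?mulr0 // unitrM negb_and gU.
have h0 : \sum_(h | h \is a GRing.unit) chi (g * h) = 0.
  rewrite -[RHS]chi_sum [RHS](reindex_inj (mulrI gU)).
  by apply: eq_bigl => h; rewrite unitrM gU.
rewrite -[chi g]opprK -chi_s s_unit_sum mulrN mulr_sumr.
rewrite -[RHS]opprK; congr (- _).
rewrite -sumrN -[LHS]subr0 -[X in _ - X]h0 -sumrB; apply: eq_bigr => h hU.
by rewrite mulrA sE //; ring.
Qed.

(* Equality case of the triangle inequality in [chi_conv]. *)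
Lemma chi_rigid : (forall g, chi g = 0) \/
  (forall g, g \is a GRing.unit -> chi g * chi g = 1) /\
  (forall g h, chi (g * h) = chi g * chi h).
Proof.
have [/forallP all0|] := boolP [forall g, chi g == 0].
  by left=> g; apply/eqP.
rewrite negb_forall => /existsP[g0 g00]; right.
(* Values at most 1 whose sum over the units reaches their number are all equal to 1. *)
have avg (t : T -> R) : (forall h, t h <= 1) -> c <= \sum_(h | h \is a GRing.unit) t h ->
    forall h, h \is a GRing.unit -> t h = 1.
  move=> t1 ct h hU; apply/eqP; rewrite eq_sym -subr_eq0; apply/eqP.
  apply: (@psumr_eq0P R T (fun h => h \is a GRing.unit) (fun h => 1 - t h)) => //.
    by move=> i _; rewrite subr_ge0.
  apply/eqP; rewrite eq_le sumr_ge0 ?andbT; last by move=> i _; rewrite subr_ge0.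
  by rewrite sumrB -c_card subr_le0.
(* At a maximum of [|chi|], [chi_conv] forces [|chi| = 1] on all units. *)
have [gm gmP] : exists gm, forall g, `|chi g| <= `|chi gm|.
  exists [arg max_(i > g0) `|chi i|]%O.
  by case: arg_maxP => // i _ hi g; exact: hi.
have gm0 : 0 < `|chi gm| by apply: lt_le_trans (gmP g0); rewrite normr_gt0.
have abs1 h : h \is a GRing.unit -> `|chi h| = 1.
  move=> hU; rewrite -[h]invrK; apply: (avg (fun h => `|chi h^-1|)) => //; last by rewrite unitrV.
  rewrite -(ler_pM2r gm0) -{1}(gtr0_norm c_gt0) -normrM chi_conv.
  apply: le_trans (ler_norm_sum _ _ _) _; rewrite mulr_suml.
  by apply: ler_sum => k _; rewrite normrM ler_wpM2l.
have sq g : g \is a GRing.unit -> chi g * chi g = 1.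
  by move=> gU; rewrite -expr2 -real_normK ?num_real // abs1 // expr1n.
split=> // g h.
have [gU|gU] := boolP (g \is a GRing.unit); last first.
  by rewrite (chi0 gU) mul0r chi0 // unitrM negb_and gU.
have [hU|hU] := boolP (h \is a GRing.unit); last first.
  by rewrite (chi0 hU) mulr0 chi0 // unitrM negb_and hU orbT.
(* For fixed [k] these terms sum over [l] to [c * chi k * chi k = c], so [avg] applies again. *)
have key k l : k \is a GRing.unit -> l \is a GRing.unit -> chi k * (chi l^-1 * chi (k * l)) = 1.
  move=> kU lU; apply: (avg (fun l => chi k * (chi l^-1 * chi (k * l)))) => //.
    move=> x; apply: le_trans (ler_norm _) _; rewrite !normrM.
    by rewrite !mulr_ile1 // mulr_ge0.
  by rewrite -mulr_sumr -chi_conv mulrCA sq // mulr1.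
have h1 := key g h gU hU.
have hV : chi h^-1 = chi h.
  have := key h^-1 h; rewrite unitrV mulVr // => /(_ hU hU).
  have := key 1 h (unitr1 _) hU; rewrite mul1r => e1 e2.
  have s1 := sq 1 (unitr1 _); have sh := sq h hU.
  have shV := sq h^-1; rewrite unitrV in shV; have {}shV := shV hU.
  have c1 : chi 1 = 1.
    by have := key 1 1 (unitr1 _) (unitr1 _); rewrite invr1 mulr1 s1 mulr1.
  have : chi h^-1 * chi h = 1 by rewrite c1 mul1r in e1.
  by move=> e3; rewrite -[LHS]mulr1 -sh mulrA e3 mul1r.
rewrite hV in h1.
have sg := sq g gU; have sh := sq h hU.
by rewrite -[LHS]mul1r -[1]mulr1 -{1}sg -sh -[RHS]mulr1 -h1; ring.
Qed.

End Rigidity.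

(** * Positive density of the class 1 *)

Section PrimesInClassOne.
Variable R : realType.

Section Modulus.
Variable w : nat.
Notation T := 'I_w.+2.
Let c : R := \sum_(h : T | h \is a GRing.unit) 1.
Let s := dens R (w := w).
(** The point mass at 1 minus the uniform distribution on the units; [psi0] averages its translates
    with weights [s], and [chi] rescales this to [1 - c * s g^-1] on units. *)
Let phi0 (x : T) : R := (x == 1)%:R - (x \is a GRing.unit)%:R / c.
Let psi0 (g : T) : R := \sum_h s h * phi0 (g * h).
Let chi (g : T) : R := - c * psi0 g.

Let c_gt0 : 0 < c.
Proof. by rewrite /c (bigD1 1) ?unitr1 //= ltr_wpDr // sumr_ge0. Qed.

Let phi0_mean0 : supp_mean0 phi0.
Proof.
split=> [x xU|].
  rewrite /phi0 (negbTE xU) mul0r subr0; case: eqP => // x1.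
  by rewrite x1 unitr1 in xU.
rewrite /phi0 sumrB (bigD1 1) //= ?eqxx big1 ?addr0; last by move=> i /negbTE ->.
rewrite -mulr_suml -[X in X / c](_ : c = _) ?divff ?subrr ?gt_eqF //.
by rewrite /c big_mkcond; apply: eq_bigr => h _; case: ifP.
Qed.

(** By [dens_Lsum] the limits of the sums for [phi0] average to zero, so only the truncation errors
    are left. *)
Let psi0_Lsum : exists2 C : R, 0 <= C & forall g y, `|Lsum psi0 g y| <= C / y.+1%:R.
Proof.
have [l [C [C0 hl]]] := Lsum_cvg phi0_mean0.
exists C => // g y.
have -> : Lsum psi0 g y = \sum_h s h * (Lsum phi0 (g * h) y - l (g * h)).
  under [RHS]eq_bigr do rewrite mulrBr; rewrite sumrB (dens_Lsum phi0_mean0 C0 hl) subr0.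
  rewrite /Lsum; under [RHS]eq_bigr do rewrite mulr_sumr.
  rewrite exchange_big; apply: eq_bigr => m _ /=.
  rewrite /psi0 mulr_suml; apply: eq_bigr => h _.
  by rewrite -mulrA; congr (_ * (phi0 _ / _)); rewrite mulrAC.
apply: le_trans (ler_norm_sum _ _ _) _.
have -> : C / y.+1%:R = \sum_h s h * (C / y.+1%:R) by rewrite -mulr_suml sum_dens mul1r.
apply: ler_sum => h _; rewrite normrM (ger0_norm (dens_ge0 _ h)) ler_wpM2l ?dens_ge0 //.
by rewrite distrC.
Qed.

Let chi0 g : g \isn't a GRing.unit -> chi g = 0.
Proof.
move=> gU; rewrite /chi /psi0 big1 ?mulr0 // => h _.
by case: phi0_mean0 => -> //; rewrite ?mulr0 // unitrM negb_and gU.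
Qed.

Let chiE g : g \is a GRing.unit -> chi g = 1 - c * s g^-1.
Proof.
move=> gU; rewrite /chi /psi0 /phi0.
under eq_bigr do rewrite mulrBr; rewrite sumrB.
rewrite (bigD1 g^-1) //= divrr // eqxx mulr1 big1 ?addr0; last first.
  move=> h hg; case: eqP => [E|]; last by rewrite mulr0.
  by move: hg; rewrite -[h](mulKr gU) E mulr1 eqxx.
have -> : \sum_h s h * ((g * h \is a GRing.unit)%:R / c) = c^-1.
  rewrite -[RHS]mul1r -[X in _ = X * _](sum_dens R w) mulr_suml; apply: eq_bigr => h _.
  rewrite unitrM gU /=; case: (boolP (h \is a GRing.unit)) => hU; first by rewrite mul1r.
  by rewrite /s dens_nonunit // !mul0r.
by rewrite mulNr mulrBr mulfV ?gt_eqF // opprB.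
Qed.

Let chi_s g : \sum_h s h * chi (g * h) = - chi g.
Proof.
have [C C0 hC] := psi0_Lsum.
rewrite /chi; under eq_bigr do rewrite mulrCA.
by rewrite -mulr_sumr (dens_Lsum0 C0 hC) mulrN.
Qed.

(** If [chi] vanishes then [s 1 = 1/c]. Otherwise it is a real character whose sum at 1 is zero by
    [psi0_Lsum], contradicting [L1_neq0]. *)
Lemma dens_one_gt0 : 0 < dens R (1 : 'I_w.+2).
Proof.
have := chi_rigid (erefl c) (@dens_ge0 R w) (sum_dens R w) (@dens_nonunit R w) chi0 chiE chi_s.
case=> [chi_0|[sq mult]].
  have := chiE (unitr1 _); rewrite chi_0 invr1 => /eqP.
  rewrite eq_sym subr_eq0 => /eqP E.
  by rewrite -(pmulr_rgt0 _ c_gt0) -[dens _ _]/(s 1) -E.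
have [C C0 hC] := psi0_Lsum.
exfalso.
have psiE g : psi0 g = - c^-1 * chi g.
  by rewrite /chi mulrA mulrNN mulVf ?mul1r // gt_eqF.
have chi_mean0 : supp_mean0 chi.
  split; first exact: chi0.
  rewrite /chi -mulr_sumr [X in _ * X](_ : _ = 0) ?mulr0 // /psi0 exchange_big big1 // => h _.
  rewrite -mulr_sumr; under eq_bigr do rewrite mulrC.
  by rewrite (supp_mean0_mul h phi0_mean0).2 mulr0.
have [B B0 hB] := sum_period_tail chi_mean0.
have chi1 : chi 1 = 1 by rewrite -{1}[1]mulr1 mult sq // unitr1.
apply: (@L1_neq0 R (fun n => chi n%:R) B) => //.
- by move=> m n; rewrite natrM mult.
- move=> n; have [/sq/eqP|/chi0 ->] := boolP ((n%:R : T) \is a GRing.unit).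
    by rewrite -expr2 sqrf_eq1 => /orP[/eqP ->|/eqP ->]; constructor.
  by constructor.
- by move=> m k; have := hB 1 m k; under eq_bigr do rewrite mul1r.
apply/cvgrPdist_le => e e0; near=> N.
rewrite sub0r normrN.
have -> : \sum_(1 <= n < N.+1) chi n%:R / n%:R = - c * Lsum psi0 1 N.
  by rewrite /Lsum mulr_sumr; apply: eq_bigr => m _; rewrite mul1r /chi mulrA.
rewrite normrM normrN (gtr0_norm c_gt0); apply: le_trans (ler_wpM2l (ltW c_gt0) (hC _ _)) _.
rewrite mulrA ler_pdivrMr ?ltr0n // -ler_pdivrMl //.
near: N; exists (Num.truncn (e^-1 * (c * C))).+1 => // n /= hn.
by apply: le_trans (ltW (truncnS_gt _)) _; rewrite ler_nat (leq_trans hn).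
Unshelve. all: by end_near. Qed.

(** Were the sum bounded, its tail beyond some [y] would be at most [delta / 4]; bounding [ln p] by
    [ln x] there would give [delta <= delta / 4] for the density [delta > 0]. *)
Lemma sum_inv_primes_class1 (C : R) : exists X,
  C < \sum_(1 <= p < X.+1 | prime p && (p%:R == 1 :> T)) p%:R^-1.
Proof.
apply: contrapT => /forallNP hC.
pose P p := prime p && (p%:R == 1 :> T).
pose V x : R := \sum_(1 <= p < x.+1 | P p) p%:R^-1.
have V_le x : V x <= C by rewrite leNgt; apply/negP; exact: hC.
have d0 := dens_one_gt0; set delta := dens _ _ in d0.
have hs : has_sup (range V).
  by split; [exists (V 0%N), 0%N|exists C => _ [x _ <-]].
have [_ [y _ <-] hy] : exists2 v, range V v & sup (range V) - delta / 4 < v.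
  by apply: sup_adherent => //; rewrite divr_gt0.
have tail x : (y <= x)%N -> \sum_(y.+1 <= p < x.+1 | P p) p%:R^-1 <= delta / 4.
  move=> yx; have : V x <= sup (range V) by apply: sup_upper_bound => //; exists x.
  by rewrite /V (big_cat_nat (n := y.+1)) //= -/(V y); lra.
pose K : R := 2 + \sum_(1 <= p < y.+1 | P p) ln p%:R / p%:R.
have bd x : (y <= x)%N -> mangoldt_avg (fun g : T => (g == 1)%:R) x <= K + delta / 4 * lx R x.
  move=> yx; rewrite /mangoldt_avg (bigID (fun d => ~~ prime d)) /= -addrA; apply: lerD.
    apply: le_trans (sum_nonprime_vonMangoldt R x); apply: ler_sum => d _.
    by rewrite ler_piMr ?mulr_ge0 ?vonMangoldt_ge0 // lern1 leq_b1.
  apply: (@le_trans _ _ (\sum_(1 <= p < x.+1 | P p) ln p%:R / p%:R)).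
    rewrite le_eqVlt; apply/orP; left; apply/eqP; rewrite big_mkcond [RHS]big_mkcond.
    apply: eq_bigr => p _; rewrite /P negbK; case: ifP => //= pp.
    by rewrite vonMangoldt_prime //; case: ifP => _; rewrite ?mulr1 ?mulr0.
  rewrite (big_cat_nat (n := y.+1)) //= lerD2l.
  apply: (@le_trans _ _ (\sum_(y.+1 <= p < x.+1 | P p) ln x%:R * p%:R^-1)).
    rewrite big_nat_cond [X in _ <= X]big_nat_cond; apply: ler_sum => p /andP[/andP[_ px] _].
    by rewrite ler_wpM2r // ler_ln_nat.
  rewrite -mulr_sumr mulrC; apply: le_trans (ler_wpM2r (ln_nat_ge0 _ _) (tail _ yx)) _.
  by rewrite /lx ler_wpM2l ?divr_ge0 ?ltW // ltrDl.
have h0 := lx_inv0 K.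
have hv : (fun x => K / lx R x + delta / 4) @ \oo --> 0 + delta / 4.
  by apply: cvgD => //; exact: cvg_cst.
have : delta <= delta / 4.
  rewrite -[X in _ <= X]add0r -(ulim_lim hv) /delta /dens; apply: ulim_le.
  - exact: bnd_dens.
  - apply: bndD; last exact: bnd_cst.
    exists `|K| => n; rewrite normrM normfV (gtr0_norm (lx_gt0 _ _)).
    by rewrite ler_piMr // invf_le1 ?lx_gt0 // /lx lerDr ln_nat_ge0.
  exists y => // x /= yx; rewrite ler_pdivrMr ?lx_gt0 // mulrDl divfK ?bd //.
  by rewrite gt_eqF // lx_gt0.
by move: d0; lra.
Qed.

End Modulus.

Lemma sum_inv_primes_mod (W : nat) (C : R) : (0 < W)%N -> exists X,
  C < \sum_(1 <= p < X.+1 | primes_mod W p) p%:R^-1.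
Proof.
(* The modulus [2 W] covers [W = 1], as [w.+2] is at least 2; its class 1 lies in the class 1 modulo
   [W]. *)
move=> W0; have [w wE] : exists w, w.+2 = (W * 2)%N.
  by case: W W0 => // W _; exists (W * 2)%N; rewrite mulSn.
have [X hX] := sum_inv_primes_class1 w C; exists X; apply: lt_le_trans hX _.
rewrite big_mkcond [X in _ <= X]big_mkcond; apply: ler_sum => p _.
rewrite /primes_mod /=; case: (boolP (prime p)) => //= pp.
case: eqP => [E|_] /=; last by case: ifP.
suff h : (p == 1 %[mod W])%N by rewrite h ?pp.
have : (p %% w.+2 = 1)%N.
  by have := congr1 val E; rewrite /= (@val_Zp_nat w.+2).
by move=> h; rewrite -(@modn_dvdm w.+2 p W) ?h // wE dvdn_mulr.
Qed.

End PrimesInClassOne.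

(** * Dilation invariance of logarithmic averages *)

Section RealLogAverage.
Variable R : realType.
Implicit Types (B : seq nat) (h : nat -> R).

Definition Relog B h : R := (\sum_(n <- B) h n / n%:R) / (\sum_(n <- B) n%:R^-1).

Definition harm B : R := \sum_(n <- B) n%:R^-1.

Lemma harm_ge0 B : 0 <= harm B.
Proof. by apply: sumr_ge0 => n _; rewrite invr_ge0. Qed.

Lemma RelogD B h h' : Relog B (fun n => h n + h' n) = Relog B h + Relog B h'.
Proof.
rewrite /Relog -mulrDl -big_split; congr (_ / _).
by apply: eq_bigr => n _; rewrite mulrDl.
Qed.

Lemma RelogZ B c h : Relog B (fun n => c * h n) = c * Relog B h.
Proof.
rewrite /Relog mulrA mulr_sumr; congr (_ / _).
by apply: eq_bigr => n _; rewrite mulrA.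
Qed.

Lemma Relog_norm B h C : (forall n, `|h n| <= C) -> `|Relog B h| <= C.
Proof.
move=> hC; have C0 : 0 <= C by apply: le_trans (hC 0%N).
have H0 := harm_ge0 B; rewrite /Relog -/(harm B) normrM normfV (ger0_norm H0).
have [->|Hn] := eqVneq (harm B) 0; first by rewrite invr0 mulr0.
rewrite ler_pdivrMr ?lt_def ?Hn // /harm mulr_sumr.
apply: le_trans (ler_norm_sum _ _ _) _; apply: ler_sum => n _.
by rewrite normrM normfV [`|n%:R|]ger0_norm // ler_wpM2r // invr_ge0.
Qed.

Lemma Relog_le B h h' : (forall n, h n <= h' n) -> Relog B h <= Relog B h'.
Proof.
move=> hh; rewrite ler_wpM2r ?invr_ge0 ?harm_ge0 //; apply: ler_sum => n _.
by rewrite ler_wpM2r // invr_ge0.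
Qed.

Lemma Relog_cst B c : harm B != 0 -> Relog B (fun=> c) = c.
Proof. by move=> H0; rewrite /Relog -mulr_sumr -/(harm B) mulfK. Qed.

Lemma harm_le m n (P : pred nat) : (m <= n)%N ->
  harm [seq p <- interval_seq m | P p] <= harm [seq p <- interval_seq n | P p].
Proof.
move=> mn; rewrite /harm !big_filter /interval_seq.
rewrite [X in _ <= X](big_cat_nat (n := m.+1)) //= lerDl sumr_ge0 //.
Qed.

Lemma harm_primes_oo W (M : nat -> nat) (C : R) : (0 < W)%N ->
  (forall t, (M t < M t.+1)%N) ->
  \forall t \near \oo, C <= harm (primes_mod_seq W (M t)).
Proof.
move=> W0 Mi; have [X hX] := sum_inv_primes_mod C W0.
exists X => // t /= Xt; apply: le_trans (ltW hX) _.
rewrite -big_filter -/(harm _); apply: harm_le.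
by apply: leq_trans Xt _; elim: t => // t; move/leq_ltn_trans; apply.
Qed.

(** Modulus 1 admits all primes, whose reciprocals already diverge. *)
Lemma harm_interval_oo (N : nat -> nat) (C : R) : (forall s, (N s < N s.+1)%N) ->
  \forall s \near \oo, C <= harm (interval_seq (N s)).
Proof.
move=> Ni; have := harm_primes_oo C (ltn0Sn 0) Ni; apply: filterS => s h.
apply: le_trans h _; rewrite /harm big_filter big_mkcond; apply: ler_sum => n _.
by case: ifP => //; rewrite invr_ge0.
Qed.

End RealLogAverage.

(** * Mean functionals and the Turan-Kubilius inequality *)

Section Functionals.
Variables (R : realType) (N M : nat -> nat) (W : nat).
Hypothesis N_incr : forall s, (N s < N s.+1)%N.
Hypothesis M_incr : forall t, (M t < M t.+1)%N.
Hypothesis W_gt0 : (0 < W)%N.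

Definition Lavg (h : nat -> R) : R := ulim (fun s => Relog (interval_seq (N s)) h).
Definition Pavg (h : nat -> R) : R := ulim (fun t => Relog (primes_mod_seq W (M t)) h).

Lemma bnd_Relog (B : nat -> seq nat) (h : nat -> R) : bnd h -> bnd (fun s => Relog (B s) h).
Proof. by case=> C hC; exists C => s; apply: Relog_norm. Qed.

Lemma LavgD h h' : bnd h -> bnd h' -> Lavg (fun n => h n + h' n) = Lavg h + Lavg h'.
Proof.
move=> b b'; rewrite /Lavg -ulimD; try exact: bnd_Relog.
by congr ulim; apply/funext => s; rewrite RelogD.
Qed.

Lemma LavgZ c h : bnd h -> Lavg (fun n => c * h n) = c * Lavg h.
Proof.
move=> b; rewrite /Lavg -ulimZ; last exact: bnd_Relog.
by congr ulim; apply/funext => s; rewrite RelogZ.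
Qed.

Lemma Lavg_le h h' : bnd h -> bnd h' -> (forall n, h n <= h' n) -> Lavg h <= Lavg h'.
Proof.
move=> b b' hh; apply: ulim_le; try exact: bnd_Relog.
by apply: nearW => s; exact: Relog_le.
Qed.

Lemma Lavg_norm h C : (forall n, `|h n| <= C) -> `|Lavg h| <= C.
Proof. by move=> hC; apply: ulim_norm => s; exact: Relog_norm. Qed.

Lemma Lavg_cst c : Lavg (fun=> c) = c.
Proof.
apply: ulim_lim; apply: cvg_near_cst.
apply: (filterS _ (harm_interval_oo (1 : R) N_incr)) => s h.
by apply: Relog_cst; rewrite gt_eqF // (lt_le_trans _ h).
Qed.

Lemma Lavg_sum I (r : seq I) (h : I -> nat -> R) : (forall i, bnd (h i)) ->
  Lavg (fun n => \sum_(i <- r) h i n) = \sum_(i <- r) Lavg (h i).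
Proof.
move=> b; elim: r => [|i r IH].
  by rewrite big_nil -[RHS]Lavg_cst; congr Lavg; apply/funext => n; rewrite big_nil.
rewrite big_cons -IH -LavgD //; last exact: bnd_sum.
by congr Lavg; apply/funext => n; rewrite big_cons.
Qed.

Lemma PavgD h h' : bnd h -> bnd h' -> Pavg (fun n => h n + h' n) = Pavg h + Pavg h'.
Proof.
move=> b b'; rewrite /Pavg -ulimD; try exact: bnd_Relog.
by congr ulim; apply/funext => s; rewrite RelogD.
Qed.

Lemma PavgZ c h : bnd h -> Pavg (fun n => c * h n) = c * Pavg h.
Proof.
move=> b; rewrite /Pavg -ulimZ; last exact: bnd_Relog.
by congr ulim; apply/funext => s; rewrite RelogZ.
Qed.

Lemma Pavg_le h h' : bnd h -> bnd h' -> (forall n, h n <= h' n) -> Pavg h <= Pavg h'.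
Proof.
move=> b b' hh; apply: ulim_le; try exact: bnd_Relog.
by apply: nearW => s; exact: Relog_le.
Qed.

Lemma Pavg_norm h C : (forall n, `|h n| <= C) -> `|Pavg h| <= C.
Proof. by move=> hC; apply: ulim_norm => s; exact: Relog_norm. Qed.

Lemma Pavg_cst c : Pavg (fun=> c) = c.
Proof.
apply: ulim_lim; apply: cvg_near_cst.
apply: (filterS _ (harm_primes_oo (1 : R) W_gt0 M_incr)) => s h.
by apply: Relog_cst; rewrite gt_eqF // (lt_le_trans _ h).
Qed.

Lemma Pavg_sum I (r : seq I) (h : I -> nat -> R) : (forall i, bnd (h i)) ->
  Pavg (fun n => \sum_(i <- r) h i n) = \sum_(i <- r) Pavg (h i).
Proof.
move=> b; elim: r => [|i r IH].
  by rewrite big_nil -[RHS]Pavg_cst; congr Pavg; apply/funext => n; rewrite big_nil.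
rewrite big_cons -IH -PavgD //; last exact: bnd_sum.
by congr Pavg; apply/funext => n; rewrite big_cons.
Qed.

(** Substituting [n = d n'] in the sum over multiples of [d] shortens the range from [m] to
    [m %/ d]; the lost block is bounded while the normalisation diverges. *)
Lemma Lavg_dilate d F : (0 < d)%N -> bnd F ->
  Lavg (fun n => F (d * n)%N) = d%:R * Lavg (fun n => (d %| n)%:R * F n).
Proof.
move=> d0 bF; have [C C0 hC] := bnd_ge0 bF.
have d0' : d%:R != 0 :> R by rewrite pnatr_eq0 -lt0n.
have b2 : bnd (fun n => (d %| n)%:R * F n).
  exists C => n; rewrite normrM -[X in _ <= X]mul1r ler_pM //.
  by rewrite normr_nat lern1 leq_b1.
rewrite -LavgZ //; apply: ulim_eq; try apply: bnd_Relog.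
- by exists C => n.
- by apply: bndM => //; exact: bnd_cst.
apply/cvgrPdist_le => e e0.
near=> s.
have H1 : 1 <= harm R (interval_seq (N s)) by near: s; exact: harm_interval_oo.
have He : C * d%:R / e <= harm R (interval_seq (N s)) by near: s; exact: harm_interval_oo.
have H0 : 0 < harm R (interval_seq (N s)) by apply: lt_le_trans H1.
rewrite sub0r normrN /Relog -mulrBl -/(harm R _) normrM normfV (gtr0_norm H0).
rewrite ler_pdivrMr // mulrC -ler_pdivrMr //; apply: le_trans He.
rewrite ler_pM2r ?invr_gt0 //; move: (N s) => m.
have -> : \sum_(n <- interval_seq m) d%:R * ((d %| n)%:R * F n) / n%:R =
    \sum_(1 <= n < (m %/ d).+1) F (d * n)%N / n%:R.
  rewrite -(sum_multiples m (fun n => F (d * n)%N / n%:R) d0) [RHS]big_mkcond.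
  apply: eq_big_nat => n /andP[n0 _]; case: ifP => dn; last by rewrite mul0r mulr0 mul0r.
  have nE : n = (d * (n %/ d))%N by rewrite mulnC divnK.
  have ne : n%:R = d%:R * (n %/ d)%:R :> R by rewrite -natrM -nE.
  by rewrite -nE mul1r ne invfM mulrACA divff // mul1r.
rewrite /interval_seq (big_cat_nat (n := (m %/ d).+1)) //=; last by rewrite ltnS leq_div.
rewrite addrAC subrr add0r.
(* In the lost block [1/n <= d/m], and there are at most [m] terms, so the total is at most
   [C d]. *)
apply: (@le_trans _ _ (\sum_((m %/ d).+1 <= n < m.+1) C * (d%:R / m%:R))).
  apply: le_trans (ler_norm_sum _ _ _) _; apply: ler_sum_nat => n /andP[nd nm].
  have n0 : (0 < n)%N by apply: leq_trans nd.
  rewrite normrM normfV [`|n%:R|]ger0_norm // ler_pM //.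
  rewrite ler_pdivlMr; last by rewrite ltr0n (leq_trans n0).
  rewrite mulrC ler_pdivrMr ?ltr0n // -natrM ler_nat mulnC.
  by rewrite ltnW // -ltn_divLR.
rewrite sumr_const_nat -mulrnAr ler_wpM2l // -mulr_natr.
have [->|m0] := posnP m; first by rewrite invr0 mulr0 ?mul0r.
rewrite mulrAC ler_pdivrMr ?ltr0n // ler_wpM2l // ler_nat.
by rewrite subSS leq_subr.
Unshelve. all: by end_near. Qed.

Lemma Lavg_dvd d : (0 < d)%N -> Lavg (fun n => (d %| n)%:R) = d%:R^-1.
Proof.
move=> d0; have := @Lavg_dilate d (fun=> 1) d0 (bnd_cst 1).
under [X in _ = _ * Lavg X]eq_fun do rewrite mulr1.
rewrite Lavg_cst => /esym E; have d0' : d%:R != 0 :> R by rewrite pnatr_eq0 -lt0n.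
by rewrite -[LHS](mulKf d0') E mulr1.
Qed.

(** The number of [p] in [Ps] dividing [n], minus its mean [harm R Ps]. *)
Let D (Ps : seq nat) (n : nat) : R := \sum_(p <- Ps) ((p %| n)%:R - p%:R^-1).

Let bnd_dvd d : bnd (fun n => (d %| n)%:R : R).
Proof. by exists 1 => n; rewrite normr_nat lern1 leq_b1. Qed.

Let bnd_dev p : bnd (fun n => (p %| n)%:R - p%:R^-1 : R).
Proof. by apply: bndD => //; exact: bnd_cst. Qed.

(** Divisibilities by distinct primes are uncorrelated, so only the variances [1/p - 1/p^2]
    remain. *)
Lemma turan_kubilius (Ps : seq nat) : uniq Ps -> all prime Ps ->
  Lavg (fun n => D Ps n ^+ 2) <= harm R Ps.
Proof.
move=> uP pP.
have -> : (fun n => D Ps n ^+ 2) = (fun n => \sum_(p <- Ps) \sum_(q <- Ps)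
    ((p %| n)%:R - p%:R^-1) * ((q %| n)%:R - q%:R^-1)).
  apply/funext => n; rewrite expr2 /D mulr_suml; apply: eq_bigr => p _.
  by rewrite mulr_sumr.
rewrite Lavg_sum; last by move=> p; apply: bnd_sum => q; exact: bndM.
rewrite /harm [X in X <= _]big_seq [X in _ <= X]big_seq; apply: ler_sum => p pPs.
have pp := allP pP _ pPs; have p0 := prime_gt0 pp.
rewrite Lavg_sum; last by move=> q; exact: bndM.
have cov q : q \in Ps -> Lavg (fun n => ((p %| n)%:R - p%:R^-1) * ((q %| n)%:R - q%:R^-1))
   = if q == p then p%:R^-1 - p%:R^-1 * p%:R^-1 else 0.
  move=> qPs; have qp := allP pP _ qPs; have q0 := prime_gt0 qp.
  have -> : (fun n => ((p %| n)%:R - p%:R^-1) * ((q %| n)%:R - q%:R^-1)) =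
     (fun n => ((lcmn p q %| n)%:R + - q%:R^-1 * (p %| n)%:R) +
         (- p%:R^-1 * (q %| n)%:R + p%:R^-1 * q%:R^-1)) :> (nat -> R).
    apply/funext => n; rewrite dvdn_lcm.
    by case: (p %| n)%N; case: (q %| n)%N => /=; ring.
  have bZ c d : bnd (fun n => c * (d %| n)%:R : R) by apply: bndM => //; exact: bnd_cst.
  rewrite !LavgD;
    try (repeat (first [exact: bnd_cst|exact: bnd_dvd|exact: bZ|apply: bndD])).
  rewrite Lavg_cst !LavgZ // !Lavg_dvd ?lcmn_gt0 ?p0 //.
  have [->|qp'] := eqVneq q p.
    by rewrite /lcmn gcdnn mulnK //; ring.
  have -> : lcmn p q = (p * q)%N.
    have := muln_lcm_gcd p q; rewrite (eqP (_ : coprime p q)) ?muln1 //.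
    by rewrite prime_coprime // dvdn_prime2 // eq_sym.
  by rewrite natrM invfM; ring.
rewrite (eq_big_seq _ cov) -big_mkcond /= -big_filter.
rewrite (_ : [seq i <- Ps | i == p] = [:: p]) ?big_seq1; last exact: filter_pred1_uniq.
by rewrite gerBl mulr_ge0 // invr_ge0.
Qed.

(** By [Lavg_dilate] the difference is the mean of [D * F], and [|D| <= dl + D^2 / dl] brings in the
    variance; [dl] is left free for optimisation. *)
Lemma elliott_bound (Ps : seq nat) (F : nat -> R) (C dl : R) :
  uniq Ps -> all prime Ps -> 0 < dl -> (forall n, `|F n| <= C) ->
  `|\sum_(p <- Ps) p%:R^-1 * Lavg (fun n => F (p * n)%N) - harm R Ps * Lavg F| <=
  C * (dl + harm R Ps / dl).
Proof.
move=> uP pP dl0 hF; have C0 : 0 <= C by apply: le_trans (hF 0%N).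
have bF : bnd F by exists C.
have bD : bnd (D Ps) by apply: bnd_sum.
have -> : \sum_(p <- Ps) p%:R^-1 * Lavg (fun n => F (p * n)%N) - harm R Ps * Lavg F
   = Lavg (fun n => D Ps n * F n).
  have -> : (fun n => D Ps n * F n) = (fun n => \sum_(p <- Ps)
      ((p %| n)%:R * F n + - p%:R^-1 * F n)).
    by apply/funext => n; rewrite /D mulr_suml; apply: eq_bigr => p _; rewrite mulrDl.
  have b1 d : bnd (fun n => (d %| n)%:R * F n) by exact: bndM.
  have b2 c : bnd (fun n => c * F n) by apply: bndM => //; exact: bnd_cst.
  rewrite Lavg_sum; last by move=> p; exact: bndD.
  rewrite /harm mulr_suml -sumrB; apply: eq_big_seq => p pPs.
  have p0 := prime_gt0 (allP pP _ pPs).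
  rewrite LavgD // LavgZ // Lavg_dilate // mulrA mulVf ?mul1r ?mulNr //.
  by rewrite pnatr_eq0 -lt0n.
have bD2 : bnd (fun n => D Ps n ^+ 2) by exact: bndM.
have bb : bnd (fun n => C * dl + C / dl * (D Ps n ^+ 2)).
  by apply: bndD; [exact: bnd_cst|apply: bndM => //; exact: bnd_cst].
have up n : `|D Ps n * F n| <= C * dl + C / dl * (D Ps n ^+ 2).
  rewrite normrM mulrC -mulrA -mulrDr ler_pM // -real_normK ?num_real //.
  rewrite -(ler_pM2r dl0) mulrDl [dl^-1 * _]mulrC mulfVK ?gt_eqF //.
  by have := normr_ge0 (D Ps n); move: `|D Ps n| => u u0; nra.
have step : Lavg (fun n => C * dl + C / dl * (D Ps n ^+ 2)) <= C * (dl + harm R Ps / dl).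
  rewrite LavgD; [|exact: bnd_cst|by apply: bndM => //; exact: bnd_cst].
  rewrite Lavg_cst LavgZ // mulrDr lerD2l [harm R Ps / dl]mulrC mulrA.
  by rewrite ler_wpM2l ?turan_kubilius // divr_ge0 // ltW.
apply: le_trans step; rewrite ler_norml; apply/andP; split.
  rewrite lerNl -mulN1r -LavgZ; last exact: bndM.
  apply: Lavg_le => //; first by apply: bndM; [exact: bnd_cst|exact: bndM].
  by move=> n; rewrite mulN1r; have := up n; rewrite ler_norml lerNl => /andP[].
apply: Lavg_le => //; first exact: bndM.
by move=> n; have := up n; rewrite ler_norml => /andP[].
Qed.

End Functionals.

(** * Second moments under iterated averages *)

Section IteratedAverages.
Variables (R : realType) (N M : nat -> nat) (W : nat).
Hypothesis N_incr : forall s, (N s < N s.+1)%N.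
Hypothesis M_incr : forall t, (M t < M t.+1)%N.
Hypothesis W_gt0 : (0 < W)%N.
Notation Lavg := (@Lavg R N).
Notation Pavg := (@Pavg R M W).
Implicit Types (H : seq nat -> nat -> R) (u v : nat -> R).

(* The head of [ps] is the variable of the outermost limit. *)
Fixpoint Eavg m H : R :=
  if m is m'.+1 then Pavg (fun p => Eavg m' (fun ps => H (p :: ps)))
  else Lavg (H [::]).

Lemma Eavg_norm m H C : (forall ps n, `|H ps n| <= C) -> `|Eavg m H| <= C.
Proof.
elim: m H => [|m IH] H hH /=; first exact: Lavg_norm.
by apply: Pavg_norm => p; apply: IH.
Qed.

Lemma bnd_Eavg m (H : nat -> seq nat -> nat -> R) C :
  (forall p ps n, `|H p ps n| <= C) -> bnd (fun p => Eavg m (H p)).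
Proof. by move=> hH; exists C => p; exact: Eavg_norm. Qed.

Lemma Eavg_cst m c : Eavg m (fun _ _ => c) = c.
Proof.
elim: m => [|m IH] /=; first exact: Lavg_cst.
by under eq_fun do rewrite IH; exact: Pavg_cst.
Qed.

Lemma Eavg_lin m c H H' C C' : (forall ps n, `|H ps n| <= C) ->
  (forall ps n, `|H' ps n| <= C') ->
  Eavg m (fun ps n => c * H ps n + H' ps n) = c * Eavg m H + Eavg m H'.
Proof.
elim: m H H' => [|m IH] H H' hH hH' /=.
  have b : bnd (H [::]) by exists C.
  have b' : bnd (H' [::]) by exists C'.
  by rewrite LavgD ?LavgZ //; apply: bndM => //; exact: bnd_cst.
have b : bnd (fun p => Eavg m (fun ps => H (p :: ps))) by apply: bnd_Eavg.
have b' : bnd (fun p => Eavg m (fun ps => H' (p :: ps))) by apply: bnd_Eavg.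
rewrite -PavgZ // -PavgD //; last by apply: bndM => //; exact: bnd_cst.
by congr Pavg; apply/funext => p; rewrite IH.
Qed.

Lemma Eavg_sum m I (r : seq I) (H : I -> seq nat -> nat -> R) C :
  (forall i ps n, `|H i ps n| <= C) ->
  Eavg m (fun ps n => \sum_(i <- r) H i ps n) = \sum_(i <- r) Eavg m (H i).
Proof.
move=> hH; elim: r => [|i r IH].
  by rewrite big_nil -[RHS](Eavg_cst m); congr Eavg; do 2 apply/funext => ?; rewrite big_nil.
rewrite big_cons -IH -[X in X + _]mul1r.
rewrite -(@Eavg_lin _ _ _ _ C (\sum_(i <- r) C)) //.
  by congr Eavg; apply/funext => ps; apply/funext => n; rewrite big_cons mul1r.
by move=> ps n; apply: le_trans (ler_norm_sum _ _ _) _; exact: ler_sum.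
Qed.

Lemma Eavg_ge0 m H C : (forall ps n, 0 <= H ps n <= C) -> 0 <= Eavg m H.
Proof.
elim: m H => [|m IH] H hH /=.
  rewrite -[0](@Lavg_cst R N N_incr); apply: Lavg_le; first exact: bnd_cst.
    by exists C => n; have /andP[h1 h2] := hH [::] n; rewrite ger0_norm.
  by move=> n; have /andP[] := hH [::] n.
rewrite -[0](@Pavg_cst R M W M_incr W_gt0); apply: Pavg_le; first exact: bnd_cst.
  apply: (@bnd_Eavg _ (fun p ps => H (p :: ps)) C) => p ps n.
  by have /andP[h1 h2] := hH (p :: ps) n; rewrite ger0_norm.
by move=> p; apply: IH.
Qed.

(** The bound depends on [H] only through [C], so it passes through each further prime average by
    linearity. *)
Lemma Eavg_dilate_bound m H (Ps : seq nat) C dl :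
  uniq Ps -> all prime Ps -> 0 < dl -> (forall ps n, `|H ps n| <= C) ->
  `|\sum_(p <- Ps) p%:R^-1 * Eavg m (fun ps n => H ps (p * n)%N) - harm R Ps * Eavg m H| <=
  C * (dl + harm R Ps / dl).
Proof.
move=> uP pP dl0; elim: m H => [|m IH] H hH /=; first exact: elliott_bound.
have b1 p : bnd (fun q => Eavg m (fun ps n => H (q :: ps) (p * n)%N)).
  exact: (@bnd_Eavg _ (fun q ps n => H (q :: ps) (p * n)%N) C).
have b2 : bnd (fun q => Eavg m (fun ps => H (q :: ps))) by apply: bnd_Eavg.
have bc c u : bnd u -> bnd (fun q => c * u q) by apply: bndM; exact: bnd_cst.
have -> : \sum_(p <- Ps) p%:R^-1 * Pavg (fun q => Eavg m (fun ps n => H (q :: ps) (p * n)%N))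
     - harm R Ps * Pavg (fun q => Eavg m (fun ps => H (q :: ps))) =
   Pavg (fun q => \sum_(p <- Ps) p%:R^-1 * Eavg m (fun ps n => H (q :: ps) (p * n)%N)
      + - harm R Ps * Eavg m (fun ps => H (q :: ps))).
  rewrite PavgD; [|by apply: bnd_sum => p; exact: bc|exact: bc].
  rewrite PavgZ // Pavg_sum //; last by move=> p; exact: bc.
  by rewrite mulNr; congr (_ - _); apply: eq_bigr => p _; rewrite PavgZ.
by apply: Pavg_norm => q; rewrite mulNr; exact: (IH (fun ps => H (q :: ps))).
Qed.

(** After division by the diverging [harm], the Turan-Kubilius error tends to zero: a prime average
    absorbs the dilation. *)
Lemma Eavg_dilate m H C : (forall ps n, `|H ps n| <= C) ->
  Pavg (fun p => Eavg m (fun ps n => H ps (p * n)%N)) = Eavg m H.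
Proof.
move=> hH; have C0 : 0 <= C by apply: le_trans (hH [::] 0%N).
apply: ulim_lim; apply/cvgrPdist_le => e e0.
(* The bound is used with parameter [dl * harm]; once [harm >= dl^-2], the error relative to [harm]
   is at most [2 C dl <= e]. *)
pose dl := e / (2 * (C + 1)); have dl0 : 0 < dl by rewrite divr_gt0 ?mulr_gt0 // ltr_wpDl.
near=> t.
have hw : dl ^- 2 <= harm R (primes_mod_seq W (M t)) by near: t; exact: harm_primes_oo.
set Ps := primes_mod_seq W (M t) in hw *.
have w0 : 0 < harm R Ps by apply: lt_le_trans hw; rewrite invr_gt0 exprn_gt0.
have uP : uniq Ps by rewrite filter_uniq // iota_uniq.
have pP : all prime Ps by apply/allP => p; rewrite mem_filter => /andP[/andP[]].
rewrite distrC /Relog -/(harm R Ps).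
have -> : (\sum_(n <- Ps) Eavg m (fun ps n0 => H ps (n * n0)%N) / n%:R) / harm R Ps - Eavg m H =
   (\sum_(p <- Ps) p%:R^-1 * Eavg m (fun ps n => H ps (p * n)%N) - harm R Ps * Eavg m H) / harm R Ps.
  rewrite mulrBl [_ * Eavg m H]mulrC mulfK ?gt_eqF //.
  by congr (_ / _ - _); apply: eq_bigr => p _; rewrite mulrC.
rewrite normrM normfV (gtr0_norm w0) ler_pdivrMr //.
apply: le_trans (Eavg_dilate_bound m uP pP (_ : 0 < dl * harm R Ps) hH) _.
  by rewrite mulr_gt0.
have -> : harm R Ps / (dl * harm R Ps) = dl^-1 by rewrite invfM mulrCA divff ?mulr1 ?gt_eqF.
have h1 : dl^-1 <= dl * harm R Ps.
  by rewrite -ler_pdivrMl // -invfM -expr2.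
apply: (@le_trans _ _ (C * (2 * (dl * harm R Ps)))).
  by rewrite ler_wpM2l // mulr2n mulrDl !mul1r lerD2l.
have -> : C * (2 * (dl * harm R Ps)) = (2 * C * dl) * harm R Ps by ring.
rewrite ler_wpM2r //; first exact: ltW.
have C1 : 0 < 2 * (C + 1) by rewrite mulr_gt0 // ltr_wpDl.
by rewrite /dl mulrA ler_pdivrMr //; nra.
Unshelve. all: by end_near. Qed.

(** The real counterpart of [iter_Elog], with every limit taken along the ultrafilter. *)
Fixpoint uiter k (u : nat -> nat -> R) : R :=
  if k is k'.+1 then
    ulim (fun t => Relog (primes_mod_seq W (M t)) (fun p => uiter k' (fun q => u (p * q)%N)))
  else ulim (u 1%N).

(** The first [k] entries of [ps] belong to the outermost averages; the remaining [d] variables do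
    not occur and are averaged away. *)
Lemma Eavg_uiter k d (w : nat -> nat -> R) C : (forall q n, `|w q n| <= C) ->
  Eavg (k + d) (fun ps n => w (\prod_(x <- take k ps) x)%N n) =
  uiter k (fun q s => Relog (interval_seq (N s)) (w q)).
Proof.
elim: k w => [|k IH] w hw.
  rewrite add0n /=.
  transitivity (Eavg d (fun _ => w 1%N)).
    by congr Eavg; apply/funext => ps; rewrite take0 big_nil.
  elim: d => [|d IHd] //=; rewrite IHd; exact: Pavg_cst.
rewrite addSn /=; congr ulim; apply/funext => t; congr Relog; apply/funext => p.
rewrite -(IH (fun q => w (p * q)%N)) //.
by congr Eavg; apply/funext => ps; rewrite big_cons.
Qed.

Definition pfx k (ps : seq nat) : nat := (\prod_(x <- take k ps) x)%N.

(** The [j] outermost primes multiply [n] in both factors, so [Eavg_dilate] removes them one by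
    one. *)
Lemma Eavg_shift j m (u v : nat -> R) d C : (forall n, `|u n| <= C) ->
  (forall n, `|v n| <= C) ->
  Eavg (j + m) (fun ps n => u (pfx j ps * n)%N * v (pfx (j + d) ps * n)%N) =
  Eavg m (fun ps n => u n * v (pfx d ps * n)%N).
Proof.
move=> hu hv; have C0 : 0 <= C by apply: le_trans (hu 0%N).
elim: j => [|j IH].
  rewrite !add0n; congr Eavg; apply/funext => ps; apply/funext => n.
  by rewrite /pfx take0 big_nil mul1n.
rewrite -IH -[RHS](@Eavg_dilate _ _ (C * C)); last by move=> ps n; rewrite normrM ler_pM.
rewrite !addSn /=; congr Pavg; apply/funext => p; congr Eavg.
by apply/funext => ps; apply/funext => n; rewrite /pfx /= !big_cons !mulnA ![(p * _)%N]mulnC.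
Qed.

Definition corr k u v : R :=
  uiter k (fun q s => Relog (interval_seq (N s)) (fun n => u n * v (q * n)%N)).

Lemma Eavg_corr j d m u v C : (forall n, `|u n| <= C) -> (forall n, `|v n| <= C) ->
  (j + d <= m)%N ->
  Eavg m (fun ps n => u (pfx j ps * n)%N * v (pfx (j + d) ps * n)%N) = corr d u v.
Proof.
move=> hu hv jm; rewrite -(subnKC jm) -addnA (@Eavg_shift _ _ _ _ _ C hu hv).
have C0 : 0 <= C by apply: le_trans (hu 0%N).
rewrite (@Eavg_uiter d _ (fun q n => u n * v (q * n)%N) (C * C)) //.
by move=> q n; rewrite normrM ler_pM.
Qed.

Lemma Eavg_mean j m u C : (forall n, `|u n| <= C) -> (j <= m)%N ->
  Eavg m (fun ps n => u (pfx j ps * n)%N) = Lavg u.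
Proof.
move=> hu jm; have C0 : 0 <= C by apply: le_trans (hu 0%N).
(* The mean is treated as a correlation with the constant 1 and [d = 0]; [C + 1] bounds both
   functions. *)
have hu' n : `|u n| <= C + 1 by rewrite ler_wpDr.
have h1 (n : nat) : `|1 : R| <= C + 1 by rewrite normr1 ler_wpDl.
have := @Eavg_corr j 0 m u (fun=> 1) _ hu' h1; rewrite addn0 => /(_ jm).
have -> : (fun ps n => u (pfx j ps * n)%N * 1) = (fun ps n => u (pfx j ps * n)%N).
  by apply/funext => ps; apply/funext => n; rewrite mulr1.
move=> ->; rewrite /corr /=; congr ulim; apply/funext => s.
by congr Relog; apply/funext => n; rewrite mulr1.
Qed.

(** Nonnegativity of the variance. *)
Lemma Eavg_sqr m H C : (forall ps n, `|H ps n| <= C) ->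
  (Eavg m H) ^+ 2 <= Eavg m (fun ps n => H ps n ^+ 2).
Proof.
move=> hH; have C0 : 0 <= C by apply: le_trans (hH [::] 0%N).
set e := Eavg m H.
have he : `|e| <= C by exact: Eavg_norm.
have hH2 ps n : `|H ps n ^+ 2| <= C ^+ 2.
  by rewrite normrX lerXn2r ?nnegrE.
have : 0 <= Eavg m (fun ps n => (H ps n - e) ^+ 2).
  apply: (@Eavg_ge0 _ _ ((C + C) ^+ 2)) => ps n; rewrite sqr_ge0 /=.
  rewrite -real_normK ?num_real // lerXn2r ?nnegrE ?addr_ge0 //.
  by apply: le_trans (ler_normB _ _) _; exact: lerD.
have -> : (fun ps n => (H ps n - e) ^+ 2) =
    (fun ps n => (- 2 * e) * H ps n + (1 * (H ps n ^+ 2) + e ^+ 2)).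
  by apply/funext => ps; apply/funext => n; ring.
rewrite (@Eavg_lin _ _ _ _ C (1 * C ^+ 2 + C ^+ 2)) //; last first.
  move=> ps n; apply: le_trans (ler_normD _ _) _; rewrite !mul1r lerD //.
  by rewrite normrX lerXn2r ?nnegrE.
rewrite (@Eavg_lin _ _ _ _ (C ^+ 2) (C ^+ 2)) //; last first.
  by move=> ps n; rewrite normrX lerXn2r ?nnegrE.
rewrite Eavg_cst -/e; move: (Eavg _ _) => x; nra.
Qed.

(* The energy argument: expand the second moment of
   [\sum_r F_r(p_1 ... p_2r n)]. *)
Lemma corr_energy K (F : nat -> nat -> R) B th : (0 < K)%N ->
  (forall r n, `|F r n| <= B) ->
  (forall r s, (r < s < K)%N -> corr (2 * (s - r)) (F r) (F s) <= th) ->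
  (\sum_(r < K) Lavg (F r)) ^+ 2 <= K%:R ^+ 2 * th + K%:R * (B ^+ 2 - th).
Proof.
move=> K0 hF hth; have B0 : 0 <= B by apply: le_trans (hF 0%N 0%N).
pose m := (2 * K)%N.
have le_m (r : 'I_K) : (2 * r <= m)%N by rewrite leq_mul2l ltnW ?orbT.
(* Prefixes of even length: two distinct ones differ by [2 (s - r) >= 2] primes, which secures
   [k >= 2] in the end. *)
pose T (r : 'I_K) ps n := F r (pfx (2 * r) ps * n)%N.
have hT r ps n : `|T r ps n| <= B by exact: hF.
have -> : \sum_(r < K) Lavg (F r) = Eavg m (fun ps n => \sum_(r < K) T r ps n).
  rewrite (@Eavg_sum m _ _ T B) //; apply: eq_bigr => r _.
  by rewrite (@Eavg_mean _ _ _ B).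
apply: le_trans (@Eavg_sqr m _ (\sum_(r < K) B) _) _.
  by move=> ps n; apply: le_trans (ler_norm_sum _ _ _) _; exact: ler_sum.
have -> : (fun ps n => (\sum_(r < K) T r ps n) ^+ 2) =
    (fun ps n => \sum_(r < K) \sum_(s < K) T r ps n * T s ps n).
  apply/funext => ps; apply/funext => n; rewrite expr2 mulr_suml.
  by apply: eq_bigr => r _; rewrite mulr_sumr.
have hTT r s ps n : `|T r ps n * T s ps n| <= B * B by rewrite normrM ler_pM.
rewrite (@Eavg_sum m _ _ (fun r ps n => \sum_(s < K) T r ps n * T s ps n) (\sum_(s < K) B * B)); last first.
  by move=> r ps n; apply: le_trans (ler_norm_sum _ _ _) _; exact: ler_sum.
(* Diagonal pairs get the trivial bound [B^2], all others [th]; [(r == s)%:R] combines the cases. *)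
have pair r s : Eavg m (fun ps n => T r ps n * T s ps n) <= th + (r == s)%:R * (B ^+ 2 - th).
  wlog rs : r s / (r <= s)%N.
    move=> h; have [rs|/ltnW sr] := leqP r s; first exact: h.
    rewrite eq_sym; have := h s r sr; congr (_ <= _); congr Eavg.
    by apply/funext => ps; apply/funext => n; rewrite mulrC.
  have [<-|nrs] := eqVneq r s.
    rewrite mul1r addrC subrK; apply: le_trans (ler_norm _) _; rewrite expr2.
    exact: Eavg_norm.
  have lt_rs : (r < s)%N by rewrite ltn_neqAle nrs rs.
  rewrite mul0r addr0; have := @hth r s; rewrite lt_rs ltn_ord => /(_ isT).
  apply: le_trans; rewrite -(@Eavg_corr (2 * r) _ m _ _ B) //; last first.
    by rewrite -mulnDr subnKC // leq_mul2l ltnW ?orbT.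
  by rewrite -mulnDr subnKC.
apply: (@le_trans _ _ (\sum_(r < K) \sum_(s < K) (th + (r == s)%:R * (B ^+ 2 - th)))).
  apply: ler_sum => r _; rewrite (@Eavg_sum m _ _ (fun s ps n => T r ps n * T s ps n) (B * B)) //.
  by apply: ler_sum => s _.
have -> : \sum_(r < K) \sum_(s < K) (th + (r == s)%:R * (B ^+ 2 - th)) =
   \sum_(r < K) (K%:R * th + (B ^+ 2 - th)).
  apply: eq_bigr => r _; rewrite big_split /= sumr_const card_ord mulr_natl; congr (_ + _).
  rewrite (bigD1 r) //= eqxx mul1r big1 ?addr0 // => s.
  by rewrite eq_sym => /negbTE ->; rewrite mul0r.
by rewrite sumr_const card_ord -[X in X <= _]mulr_natl mulrDr mulrA -expr2.
Qed.

End IteratedAverages.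

(** * The Ramsey argument *)

(** Greedy choice inside [S]: finitely many earlier points impose finitely many conditions, each
    holding on a set of the ultrafilter, so a next point exists. *)
Lemma ultra_ramsey (Q : nat -> nat -> Prop) :
  ultra [set i | ultra [set j | Q i j]] ->
  exists phi : nat -> nat, forall i j, (i < j)%N ->
    (phi i < phi j)%N /\ Q (phi i) (phi j).
Proof.
set S := [set i | _] => US.
have step (l : seq nat) : exists x, (forall y, y \in l -> S y) ->
    S x /\ forall y, y \in l -> (y < x)%N /\ Q y x.
  (* The value 0 for lists not contained in [S] makes the choice function total; [histS] shows that
     such lists never arise. *)
  have [lS|nlS] := pselect (forall y, y \in l -> S y); last by exists 0%N => /nlS.
  suff /filter_ex[x [Sx hx]] : ultra (S `&` [set x | forall y, y \in l -> (y < x)%N /\ Q y x]).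
    by exists x => _.
  apply: filterI => //; elim: l lS => [|z l IH] lS; first exact: nearW.
  have h1 := IH (fun y yl => lS y (mem_behead (s := z :: l) yl)).
  have h2 : ultra [set x | Q z x] := lS z (mem_head _ _).
  have h3 : ultra [set x | (z < x)%N] by apply: ultra_oo; exists z.+1.
  apply: filterS (filterI h1 (filterI h3 h2)) => x [hx [zx qx]] y.
  by rewrite inE => /orP[/eqP ->|]; [split|exact: hx].
have [pick hpick] := choice step.
pose hist := fix hist n := if n is n'.+1 then pick (hist n') :: hist n' else [::].
have histS n : forall y, y \in hist n -> S y.
  elim: n => [|n IH] y //=; rewrite inE => /orP[/eqP ->|]; last exact: IH.
  by have [] := hpick _ IH.
exists (fun n => pick (hist n)) => i j ij.
have [_] := hpick _ (histS j); apply.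
elim: j ij => // j IH; rewrite ltnS leq_eqVlt /= inE => /orP[/eqP ->|/IH ->].
  by rewrite eqxx.
by rewrite orbT.
Qed.

Lemma ultra_forall_lt (Q : nat -> nat -> Prop) K :
  (forall k, (k < K)%N -> ultra [set j | Q k j]) ->
  ultra [set j | forall k, (k < K)%N -> Q k j].
Proof.
elim: K => [|K IH] h; first exact: nearW.
have h1 := IH (fun k kK => h k (ltnW kK)).
apply: filterS (filterI h1 (h K (ltnSn K))) => j [hj qj] k.
by rewrite ltnS leq_eqVlt => /orP[/eqP ->|/hj].
Qed.

(** * Large correlations along a subsequence *)

Section RealCorrelations.
Variables (R : realType) (N M : nat -> nat) (W : nat).
Hypothesis N_incr : forall s, (N s < N s.+1)%N.
Hypothesis M_incr : forall t, (M t < M t.+1)%N.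
Hypothesis W_gt0 : (0 < W)%N.

(** Either some even [k] is good for almost all pairs, and Ramsey gives [phi]; or Ramsey gives a
    sequence bad for the first [K] even [k] at once, against [corr_energy]. *)
Lemma corr_recurrence (F : nat -> nat -> R) (B mu th : R) :
  (forall r n, `|F r n| <= B) -> 0 <= mu -> (forall r, mu <= Lavg N (F r)) ->
  th < mu ^+ 2 ->
  exists (k : nat) (phi : nat -> nat), (2 <= k)%N /\
    forall i j, (i < j)%N -> (phi i < phi j)%N /\
      th <= corr N M W k (F (phi i)) (F (phi j)).
Proof.
move=> hF mu0 hmu hth.
pose good k i j := th <= corr N M W (2 * k.+1) (F i) (F j).
have [[k hk]|hno] := pselect (exists k, ultra [set i | ultra [set j | good k i j]]).
  have [phi hphi] := ultra_ramsey hk.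
  by exists (2 * k.+1)%N, phi; split; first by rewrite mulnS.
(* Exactly the condition under which [K^2 mu^2] exceeds the energy bound [K^2 th + K (B^2 - th)]. *)
exfalso; have [K hK] : exists K : nat, B ^+ 2 - th < K%:R * (mu ^+ 2 - th).
  exists (Num.truncn ((B ^+ 2 - th) / (mu ^+ 2 - th))).+1.
  by rewrite -ltr_pdivrMr ?subr_gt0 // truncnS_gt.
have bad : ultra [set i | ultra [set j | forall k, (k < K)%N -> ~ good k i j]].
  have : ultra [set i | forall k, (k < K)%N -> ultra [set j | ~ good k i j]].
    apply: ultra_forall_lt => k _.
    have [h|h] := in_ultra_setVsetC [set i | ultra [set j | good k i j]] ultra_ultra.
      by case: hno; exists k.
    apply: filterS h => i /= h.
    by have [//|] := in_ultra_setVsetC [set j | good k i j] ultra_ultra.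
  by apply: filterS => i /ultra_forall_lt.
have [phi hphi] := ultra_ramsey bad.
have K0 : (0 < K)%N.
  rewrite lt0n; apply: contraTneq hK => ->; rewrite mul0r -leNgt subr_ge0.
  apply: le_trans (ltW hth) _; rewrite lerXn2r ?nnegrE ?(le_trans (normr_ge0 _) (hF 0%N 0%N)) //.
  apply: le_trans (hmu 0%N) (le_trans (ler_norm _) _).
  exact: Lavg_norm.
have := @corr_energy R N M W N_incr M_incr W_gt0 K (fun r => F (phi r)) B th K0 (fun r => hF _).
have hcorr r s : (r < s < K)%N -> corr N M W (2 * (s - r)) (F (phi r)) (F (phi s)) <= th.
  move=> /andP[rs sK]; have [_ h] := hphi _ _ rs.
  have sr : (s - r = (s - r).-1.+1)%N by rewrite prednK // subn_gt0.
  have kK : ((s - r).-1 < K)%N by lia.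
  by have := h _ kK; rewrite /good -sr => /negP; rewrite -ltNge => /ltW.
move=> /(_ hcorr).
have : (K%:R * mu) ^+ 2 <= (\sum_(r < K) Lavg N (F (phi r))) ^+ 2.
  have Km : K%:R * mu = \sum_(r < K) mu by rewrite sumr_const card_ord mulr_natl.
  have le : \sum_(r < K) mu <= \sum_(r < K) Lavg N (F (phi r)) by apply: ler_sum.
  rewrite lerXn2r ?nnegrE ?Km // ?sumr_ge0 // => r _.
  exact: le_trans (hmu _).
move=> h1 h2; have := le_trans h1 h2; rewrite exprMn.
have K0' : 0 < K%:R :> R by rewrite ltr0n.
by move: hK; move: (K%:R) K0' => k k0; nra.
Qed.

Lemma limn_sup_frequently (c : nat -> R) (B d : R) : (forall j, 0 <= c j <= B) ->
  0 < d -> 0 <= limn_sup c /\ exists psi : nat -> nat,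
    (forall i j, (i < j)%N -> (psi i < psi j)%N) /\
    forall i, limn_sup c - d < c (psi i).
Proof.
move=> hc d0.
have ub n : has_ubound (sdrop c n) by exists B => _ [k _ <-]; case/andP: (hc k).
have supE n : c n <= sups c n by apply: ub_le_sup => //; exists n => /=.
have lb : lbound (range (sups c)) 0.
  by move=> _ [n _ <-]; apply: le_trans (supE n); case/andP: (hc n).
have -> : limn_sup c = inf (range (sups c)).
  apply: limn_supE; exists B; split; first exact: num_real.
  move=> x Bx n _; have /andP[h1 h2] := hc n.
  by rewrite /= ger0_norm // (le_trans h2) // ltW.
split; first by apply: lb_le_inf => //; exists (sups c 0%N), 0%N.
(* The supremum of the tail from [n] is at least the limsup, so some term of the tail comes within
   [d] of it. *)
have freq n : exists k, (n <= k)%N /\ inf (range (sups c)) - d < c k.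
  have hs : has_sup (sdrop c n) by split=> //; exists (c n), n => /=.
  have [_ [k nk <-] hk] := sup_adherent d0 hs.
  exists k; split => //; apply: le_lt_trans hk; rewrite lerD2r.
  by apply: ge_inf; [exists 0|exists n].
have [g hg] := choice freq.
pose psi := fix psi n := if n is n'.+1 then g (psi n').+1 else g 0%N.
exists psi; split; last by case=> [|i] /=; [case: (hg 0%N)|case: (hg (psi i).+1)].
move=> i j; elim: j => // j IH; rewrite ltnS leq_eqVlt => /orP[/eqP ->|/IH h].
  by case: (hg (psi j).+1).
by apply: ltn_trans h _; case: (hg (psi j).+1).
Qed.

End RealCorrelations.

(** * From complex limits to real ultrafilter limits *)

Section RealToComplex.
Variable R : realType.

Lemma Elog_real (B : seq nat) (h : nat -> R) :
  Elog B (fun n => (h n)%:C) = (Relog B h)%:C.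
Proof.
rewrite /Elog /Relog rmorphM fmorphV !rmorph_sum; congr (_ / _).
  by apply: eq_bigr => n _; rewrite rmorphM fmorphV rmorph_nat.
by apply: eq_bigr => n _; rewrite fmorphV rmorph_nat.
Qed.

(** Convergence in [R[i]] makes the real parts converge, and an ordinary limit agrees with the
    ultrafilter limit. *)
Lemma limn_real (u : nat -> R) : cvgn (fun n => (u n)%:C : R[i]) ->
  limn (fun n => (u n)%:C : R[i]) = (ulim u)%:C.
Proof.
move=> /cvg_ex[l hl].
have hu : u @ \oo --> complex.Re l.
  apply/cvgrPdist_le => e e0; move/cvgrPdist_le: hl => /(_ e%:C).
  rewrite ltcR => /(_ e0); apply: filterS => n hn.
  rewrite -lecR; apply: le_trans hn.
  have -> : complex.Re l - u n = complex.Re (l - (u n)%:C) by case: (l).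
  exact: normc_ge_Re.
have E : ulim u = complex.Re l by exact: ulim_lim.
apply: cvg_lim; first exact: (@norm_hausdorff _ R[i]).
rewrite E.
apply/cvgrPdist_le => e e0.
(* The tolerance is here a positive element of [R[i]], hence real. *)
have eE : e = (complex.Re e)%:C.
  by move: e0; rewrite ltcE; case: (e) => x y /= /andP[/eqP -> _].
move/cvgrPdist_le: hu => /(_ (complex.Re e)).
move: e0; rewrite {1}eE ltcR => e0 /(_ e0); apply: filterS => n hn.
by rewrite -rmorphB normc_def /= expr0n addr0 sqrtr_sqr eE lecR.
Qed.

(** Applies [limn_real] at each level. Agreement for [q > 0] suffices, since products of primes are
    positive. *)
Lemma iter_Elog_real W (M : nat -> nat) k (u : nat -> nat -> R) (v : nat -> nat -> R[i]) :
  (forall q s, (0 < q)%N -> v q s = (u q s)%:C) ->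
  iter_Elog_exists W M k v -> iter_Elog W M k v = (uiter M W k u)%:C.
Proof.
elim: k u v => [|k IH] u v uv /=.
  have -> : v 1%N = (fun s => (u 1%N s)%:C) by apply/funext => s; rewrite uv.
  exact: limn_real.
move=> [hex].
have -> : (fun t => Elog (primes_mod_seq W (M t)) (fun p => iter_Elog W M k (fun q => v (p * q)%N)))
  = (fun t => (Relog (primes_mod_seq W (M t)) (fun p => uiter M W k (fun q => u (p * q)%N)))%:C).
  apply/funext => t; rewrite -Elog_real /Elog; congr (_ / _); apply: eq_big_seq => p.
  rewrite mem_filter => /andP[pW _]; congr (_ / _); apply: IH; last exact: hex.
  move=> q s q0; apply: uv; rewrite muln_gt0 q0 prime_gt0 //.
  by case/andP: pW.
exact: limn_real.
Qed.

End RealToComplex.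

Theorem theorem3p6 (R : realType) (N M : nat -> nat)
    (N_pos : forall s, (0 < N s)%N) (N_incr : forall s, (N s < N s.+1)%N)
    (M_pos : forall t, (0 < M t)%N) (M_incr : forall t, (M t < M t.+1)%N)
    (A : set (int -> R[i]))
    (A_Cstar : Cstar_subalgebra A) (A_sep : sup_separable A)
    (A_aff : affinely_invariant A)
    (A_log : admits_log_averages N A)
    (A_corr : forall W : nat, (0 < W)%N ->
       admits_iterated_affine_correlations N W M A)
    (a : nat -> nat) (a_pos : forall i, (0 < a i)%N)
    (f : int -> R[i]) (Af : A f)
    (f_ge0 : forall n : nat, (0 < n)%N -> 0 <= f n%:Z) :
  forall (eps : R) (W : nat), 0 < eps -> (0 < W)%N ->
  exists (k : nat) (I : set nat), [/\ (2 <= k)%N, infinite_set I &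
    forall i j : nat, I i -> I j -> (i < j)%N ->
      iter_Elog W M k (fun p =>
        log_average N (fun n => f (a i * n)%:Z * f (a j * p * n)%:Z))
      >= (limn_sup (fun j' =>
            complex.Re (limn (log_average N (fun n => f (a j' * n)%:Z)))) ^+ 2
          - eps)%:C].
Proof.
move=> eps W eps0 W0.
have [B hB] := Cstar_bounded A_Cstar Af.
(* Positivity of [f] is known at positive integers only, so the value at 0, which no average sees,
   is set to 0. *)
pose F i n : R := if n == 0%N then 0 else complex.Re (f (a i * n)%:Z).
have fF i n : (0 < n)%N -> f (a i * n)%:Z = (F i n)%:C.
  move=> n0; have := f_ge0 (a i * n)%N; rewrite muln_gt0 a_pos n0 => /(_ isT).
  rewrite /F gtn_eqF // lecE; case: (f _) => x y /= /andP[/eqP -> _].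
  by [].
have F_ge0 i n : 0 <= F i n.
  rewrite /F; case: eqP => // /eqP; rewrite -lt0n => n0.
  have := f_ge0 (a i * n)%N; rewrite muln_gt0 a_pos n0 => /(_ isT).
  by rewrite lecE => /andP[].
have B0 : 0 <= B by rewrite -lecR rmorph0; apply: le_trans (hB 0).
have F_le i n : F i n <= B.
  rewrite /F; case: eqP => // _; apply: le_trans (ler_norm _) _.
  by rewrite -lecR; apply: le_trans (normc_ge_Re _) (hB _).
have F_norm i n : `|F i n| <= B by rewrite ger0_norm.
have meanE j : limn (log_average N (fun n => f (a j * n)%:Z)) = (Lavg N (F j))%:C.
  have := A_log _ (A_aff.2 f (a j) (a_pos j) Af).
  have -> : log_average N (fun n => f ((a j)%:Z * n%:Z)) =
      (fun s => (Relog (interval_seq (N s)) (F j))%:C).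
    apply/funext => s; rewrite /log_average -Elog_real /Elog; congr (_ / _).
    apply: eq_big_seq => n; rewrite mem_index_iota => /andP[n0 _].
    by rewrite -PoszM fF.
  by move=> /limn_real <-.
have -> : (fun j' => complex.Re (limn (log_average N (fun n => f (a j' * n)%:Z))))
    = (fun j => Lavg N (F j)).
  by apply/funext => j; rewrite meanE.
set c := limn_sup _.
have c01 j : 0 <= Lavg N (F j) <= B.
  apply/andP; split; last by apply: le_trans (ler_norm _) _; exact: Lavg_norm.
  rewrite -[0](@Lavg_cst R N N_incr); apply: Lavg_le => //; first exact: bnd_cst.
  by exists B.
(* A first use with tolerance 1 gives only [0 <= c], which is needed to define [d]. *)
have [c0 _] := limn_sup_frequently c01 (ltr01 : 0 < 1 :> R); rewrite -/c in c0.
pose d := eps / (2 * (c + 1)).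
have d0 : 0 < d by rewrite divr_gt0 // mulr_gt0 // ltr_wpDl.
have dE : d * (2 * (c + 1)) = eps by rewrite /d divfK // gt_eqF // mulr_gt0 // ltr_wpDl.
have [_ [psi [psi_incr hpsi]]] := limn_sup_frequently c01 d0; rewrite -/c in hpsi.
(* Since [2 d (c + 1) = eps], one has [mu^2 > c^2 - eps] both when [c > d] and when [c <= d], where
   [c^2 <= c d < eps]. *)
pose mu := Num.max (c - d) 0.
have [||||k [phi [k2 hphi]]] := @corr_recurrence R N M W N_incr M_incr W0
    (fun r => F (psi r)) B mu (c ^+ 2 - eps).
- by move=> r n; exact: F_norm.
- by rewrite /mu le_max lexx orbT.
- by move=> r; rewrite /mu ge_max (ltW (hpsi r)); case/andP: (c01 (psi r)).
- rewrite /mu; case: (leP (c - d) 0) => cd; first by rewrite expr0n /=; nra.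
  by nra.
have phi_incr i j : (i < j)%N -> (psi (phi i) < psi (phi j))%N.
  by move=> /hphi[h _]; exact: psi_incr.
exists k, (range (psi \o phi)); split=> //.
  apply/infiniteP; have := @inj_card_eq _ _ setT (psi \o phi).
  rewrite card_eq_le => /(_ _)/andP[] // i j _ _ /= E.
  by have [/phi_incr|/phi_incr|//] := ltngtP i j; rewrite E ltnn.
move=> _ _ [r _ <-] [s _ <-] /=.
have [rs|sr|->] := ltngtP r s; last by rewrite ltnn.
  move=> _; have [_ h] := hphi r s rs.
  rewrite (@iter_Elog_real R W M k (fun q t => Relog (interval_seq (N t))
     (fun n => F (psi (phi r)) n * F (psi (phi s)) (q * n)%N))).
  - by rewrite lecR.
  - move=> q t q0; rewrite /log_average -[RHS]Elog_real /Elog; congr (_ / _).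
    apply: eq_big_seq => n; rewrite mem_index_iota => /andP[n0 _].
    by rewrite fF // -mulnA fF ?muln_gt0 ?q0 // -rmorphM.
  (* The case [Q = 0] with the dilate of [f] by [a (psi (phi s))] as second function. *)
  have := @A_corr W W0 f _ k (a (psi (phi r))) 0 Af
    (A_aff.2 f (a (psi (phi s))) (a_pos _) Af) (ltnW k2) (a_pos _).
  congr iter_Elog_exists; apply/funext => q; congr log_average; apply/funext => n.
  by rewrite horner0 addr0 -PoszM mulnA.
by move=> /(ltn_trans (phi_incr _ _ sr)); rewrite ltnn.
Qed.
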